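(* Let $\psi=\psi(r,k)$ be a function with the following property: for all integers $k\geq 2$, $r\geq 1$ and every real $\alpha^*>0$ there exist $\epsilon^*>0$ and $t_0>0$ such that for every $k$-uniform hypergraph $G$ on $t\geq t_0$ vertices with $e(G)\geq (1-\epsilon^* )\binom{t}{k}$, every $r$-coloring of the edges of $G$ contains a monochromatic connected loose cycle packing on at least $(\psi-\alpha^* )t$ vertices. Then for any integers $k\geq 2$, $r\geq 1$, any real $\alpha>0$, and any $p=p(n)\in(0,1]$ such that $pn^{k-1}\to\infty$, asymptotically almost surely every $r$-coloring of the edges of $\mathcal{H}^{(k)}(n,p)$ contains a monochromatic loose cycle on at least $(\psi-\alpha)n$ vertices.
   Context: A $k$-uniform hypergraph $(V,E)$ is a loose cycle if there is a cyclic ordering of $V$ such that every edge consists of $k$ consecutive vertices and every two consecutive edges intersect in exactly one vertex (so $|E|=|V|/(k-1)$); when $k=2$ a single edge is also regarded as a cycle on $2$ vertices. A hypergraph is connected if its shadow graph (two vertices adjacent iff they lie in a common edge) is connected. For a $k$-uniform hypergraph $G$, a connected loose cycle packing on $t$ vertices is a connected subhypergraph $H\subseteq G$ together with vertex-disjoint loose cycles $C_1,\dots,C_\ell\subseteq H$ with $\sum_{i=1}^\ell|V(C_i)|=t$; it is monochromatic if all edges of $H$ have the same color. The random hypergraph $\mathcal{H}^{(k)}(n,p)$ is the $k$-uniform hypergraph on $[n]$ in which each $k$-subset is an edge independently with probability $p$. Asymptotically almost surely means with probability tending to $1$ as $n\to\infty$. $e(G)$ is the number of edges. *)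

(* Defs.v *)
From mathcomp Require Import all_boot all_order all_algebra.
From mathcomp Require Import boolp reals.

Set Implicit Arguments.
Unset Strict Implicit.
Unset Printing Implicit Defensive.

Import GRing.Theory.

(* The vertex set is a subset of the ambient type, so that subhypergraphs with
   fewer vertices live in the same type. *)
Record hypergraph (T : finType) := Hypergraph {
  verts : {set T};
  edges : {set {set T}};
  edges_sub : cover edges \subset verts
}.

Definition on_all (T : finType) (E : {set {set T}}) : hypergraph T :=
  Hypergraph (subsetT (cover E)).

Definition k_uniform (T : finType) (k : nat) (G : hypergraph T) : Prop :=
  forall e, e \in edges G -> #|e| = k.

Definition subhypergraph (T : finType) (H G : hypergraph T) : Prop :=
  verts H \subset verts G /\ edges H \subset edges G.

Definition shadow (T : finType) (G : hypergraph T) : rel T :=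
  fun x y => (x != y) && [exists e in edges G, (x \in e) && (y \in e)].

Definition shadow_connected (T : finType) (G : hypergraph T) : Prop :=
  {in verts G &, forall x y, connect (shadow G) x y}.

(* The k cyclically consecutive entries of s starting at position i; fewer than
   k if s is too short. *)
Definition consecutive (T : finType) (s : seq T) (k i : nat) : {set T} :=
  [set x in take k (rot i s)].

(* s is the cyclic ordering of the vertices and I lists, in increasing order,
   the positions at which the edges start, so that [cycle] ranges over the pairs
   of consecutive edges, the last and first included.  The condition
   |E| (k - 1) = |V| is not redundant: without it, for instance, two edges
   sharing one vertex would qualify. *)
Definition proper_loose_cycle (T : finType) (k : nat)
    (C : hypergraph T) : Prop :=
  exists (s : seq T) (I : seq nat),
    [/\ uniq s /\ verts C = [set x in s],
        sorted ltn I /\ all (fun i => i < size s) I,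
        edges C = [set:: [seq consecutive s k i | i <- I]],
        cycle (fun i j => #|consecutive s k i :&: consecutive s k j| == 1) I &
        #|edges C| * (k - 1) = #|verts C|].

Definition loose_cycle (T : finType) (k : nat) (C : hypergraph T) : Prop :=
  [/\ k_uniform k C, verts C != set0 &
      proper_loose_cycle k C
      \/ [/\ k = 2, #|verts C| = 2 & edges C = [set verts C]]].

(* Edge colourings are total functions on sets; only the values on edges are
   ever used. *)
Definition monochromatic (T : finType) (r : nat) (c : {set T} -> 'I_r)
    (H : hypergraph T) : Prop :=
  {in edges H &, forall e f, c e = c f}.

Definition mono_packing (T : finType) (k r : nat) (c : {set T} -> 'I_r)
    (G : hypergraph T) (t : nat) : Prop :=
  exists (H : hypergraph T) (l : nat) (C : 'I_l -> hypergraph T),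
    [/\ subhypergraph H G /\ shadow_connected H,
        monochromatic c H,
        forall i, subhypergraph (C i) H /\ loose_cycle k (C i),
        forall i j, i != j -> [disjoint verts (C i) & verts (C j)] &
        \sum_(i < l) #|verts (C i)| = t].

Definition ksubsets (k n : nat) : {set {set 'I_n}} :=
  [set e : {set 'I_n} | #|e| == k].

Local Open Scope ring_scope.

(* Probability that the random hypergraph H^(k)(n, p) satisfies P, i.e. the
   measure of P under the product of Bernoulli(p) laws over all k-subsets. *)
Definition prob_Hnp (R : realType) (k n : nat) (p : R)
    (P : hypergraph 'I_n -> Prop) : R :=
  \sum_(E in powerset (ksubsets k n) | `[< P (on_all E) >])
     \prod_(e in ksubsets k n) (if e \in E then p else 1 - p).

(* Main.v *)
(** A colour that misses a box of linear-sized vertex sets is responsible for a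
    "hole".  Since p n^(k-1) tends to infinity, a first-moment bound shows that
    every k-tuple of disjoint linear-sized sets spans an edge of some colour, and
    only this property of the random hypergraph is used.

    Start from any partition into equal clusters and consider the number of pairs
    (S, i) such that the k-set S lies in a k-tuple of clusters spanning no edge of
    colour i.  If many k-tuples of clusters have a hole in every colour, refining
    the clusters along these holes increases this bounded number by a constant
    fraction of n^k.  Hence after boundedly many steps almost all k-tuples of
    clusters are hole-free in some colour; no densities are needed.  The
    hypothesis on psi, applied to the k-graph of these tuples, yields a
    monochromatic connected loose cycle packing of the clusters.

    Each edge of the packed cycles hosts a long loose path, found by depth-first
    search, which uses half of each of its two link clusters and the whole of
    its other clusters.  As the packing lives in a connected k-graph, these paths
    are joined into one loose cycle by short paths through small reserved parts of
    the clusters. *)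
Require Import Defs.
From mathcomp Require Import all_boot all_order all_algebra zify ring lra.
From mathcomp Require Import boolp reals.

Set Implicit Arguments.
Unset Strict Implicit.
Unset Printing Implicit Defensive.

(** * Loose paths in a hole-free box *)

(** Hole-freeness says nothing about a single vertex: it only yields an edge between prescribed sets
    of at least [h] vertices each. Hence nothing is ever joined at a vertex fixed in advance. In the
    search, a contradiction comes from [h] abandoned tips at once; connecting paths are grown
    through sets of at least [h] reachable vertices; and each long path keeps [h] possible heads in
    both link clusters near either end, one of which becomes the joint.

    The potential grows because the whole hypergraph spans an edge in every tuple of clusters, so
    some colour occurs even in an irregular tuple. For that colour no set crossing the tuple is
    counted yet, whereas its hole makes at least [h ^ k] of them count after the refinement, apart
    from those meeting the vertices left over when clusters are cut to equal size. This loss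
    dictates the ratio between successive cluster sizes. *)

Definition crossing (T V : finType) (e : {set T}) (A : T -> {set V})
    (S : {set V}) : bool :=
  (S \subset \bigcup_(b in e) A b) && [forall b in e, #|S :&: A b| == 1].

(** Clusters are indexed by an abstract type: the regularity argument takes sets of clusters with
    [U] the identity, the embedding takes their indices. *)
Definition hole_free (T V : finType) (E : {set {set V}}) (h : nat)
    (e : {set T}) (U : T -> {set V}) : Prop :=
  forall A : T -> {set V},
    {in e, forall b, A b \subset U b} -> {in e, forall b, h <= #|A b|} ->
    exists2 S, S \in E & crossing e A S.

(* A loose path is encoded by blocks of [k - 1] vertices: the edge of a block
   consists of the block and of the head of the next block. *)
Definition linked (V : finType) (E : {set {set V}}) : rel (seq V) :=
  fun b b' => if b' is x :: _ then x |: [set z in b] \in E else false.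

(** A crossing edge is read as one step of a block path: its vertex in [A a] is the head of the
    following block, its vertex in [A b] the head of the block itself, and the others form the
    interior. *)
Lemma hole_free_block (T V : finType) (E : {set {set V}}) (k h : nat)
    (e : {set T}) (U A : T -> {set V}) (a b : T) :
  {in E, forall S : {set V}, #|S| = k} ->
  {in e &, forall c d, c != d -> [disjoint U c & U d]} ->
  hole_free E h e U ->
  a \in e -> b \in e -> a != b ->
  {in e, forall c, A c \subset U c} -> {in e, forall c, h <= #|A c|} ->
  exists x y I, [/\ x \in A a /\ y \in A b, (size I).+2 = k /\ uniq (y :: I),
    forall z, z \in I -> exists2 c, c \in e :\ a :\ b & z \in A c,
    {in e :\ a :\ b, forall c, count [in A c] I <= 1} &
    linked E (y :: I) [:: x]].
Proof.
move=> Ek dU hf ae be ab AU hA.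
have [S SE /andP[/subsetP Ssub /forall_inP Str]] := hf A AU hA.
have [x xS] : exists x, x \in S :&: A a.
  by apply/card_gt0P; rewrite (eqP (Str a ae)).
have [y yS] : exists y, y \in S :&: A b.
  by apply/card_gt0P; rewrite (eqP (Str b be)).
move: xS yS; rewrite !inE => /andP[xS xA] /andP[yS yA].
have disj c d z : c \in e -> d \in e -> z \in A c -> z \in A d -> c = d.
  move=> ce de zc zd; apply/eqP/negPn/negP => cd.
  have /pred0P/(_ z)/= := dU c d ce de cd.
  by rewrite (subsetP (AU c ce) z zc) (subsetP (AU d de) z zd).
have xy : x != y.
  by apply: contra_neq ab => exy; apply: (disj a b x) => //; rewrite exy.
have uniqS c z z' : c \in e -> z \in S -> z' \in S -> z \in A c -> z' \in A c ->
    z = z'.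
  move=> ce zS zS' zc zc'.
  have /eqP/cards1P[w ew] := eqP (Str c ce).
  have : z \in S :&: A c by rewrite inE zS zc.
  have : z' \in S :&: A c by rewrite inE zS' zc'.
  by rewrite ew !inE => /eqP-> /eqP->.
exists x, y, (enum (S :\ x :\ y)); split=> //.
- split; last by rewrite /= enum_uniq mem_enum !inE eqxx.
  rewrite -cardE; have := cardsD1 x S; have := cardsD1 y (S :\ x).
  by rewrite !inE xS yS eq_sym xy (Ek _ SE) /= !add1n => <- <-.
- move=> z; rewrite mem_enum !inE => /and3P[zy zx zS].
  have /bigcupP[c ce zc] := Ssub z zS.
  exists c => //; rewrite !inE ce andbT; apply/andP; split.
    by apply: contra_neq zy => ecb; apply: (uniqS b) => //; rewrite -ecb.
  by apply: contra_neq zx => ecb; apply: (uniqS a) => //; rewrite -ecb.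
- move=> c; rewrite !inE => /and3P[_ _ ce].
  rewrite -size_filter -(card_uniqP (filter_uniq _ (enum_uniq _))).
  rewrite -(eqP (Str c ce)); apply/subset_leq_card/subsetP => z.
  by rewrite mem_filter mem_enum !inE => /and4P[-> _ _ ->].
- suff E1 : x |: [set z in y :: enum (S :\ x :\ y)] = S.
    by rewrite /linked E1.
  apply/setP => z; rewrite !inE mem_enum !inE.
  case: (eqVneq z x) => [->|_]; first by rewrite xS.
  by case: (eqVneq z y) => [->|_]; rewrite ?yS.
Qed.

(** A block can be exchanged for any block with the same head without disturbing its predecessor;
    this is how paths are spliced. *)
Lemma linked_head (V : finType) (E : {set {set V}}) (b b' b'' : seq V) :
  ohead b' = ohead b'' -> linked E b b' = linked E b b''.
Proof. by case: b' => [|x b']; case: b'' => [|y b''] //= [->]. Qed.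

Definition heads (V : finType) (p : seq (seq V)) : {set V} :=
  [set y in pmap ohead p].

Section LongPath.
Variables (T V : finType) (E : {set {set V}}) (k h m : nat).
Variables (e : {set T}) (A : T -> {set V}) (u w : T).

Definition side (b : seq V) := if b is y :: _ then y \in A w else false.

Definition alternating (b b' : seq V) := linked E b b' && (side b != side b').

Lemma count_alternating p : sorted alternating p ->
  size p <= 2 * count side p + 1 /\ 2 * count side p <= size p + 1.
Proof.
suff H : sorted alternating p ->
    if p is b :: _ then
      if side b then size p <= 2 * count side p <= size p + 1
      else 2 * count side p <= size p <= 2 * count side p + 1
    else true.
  by move/H; case: p {H} => [//|b p]; case: ifP => _ /andP[]; lia.
elim: p => [//|b [|b' p] IH] /=; first by case: (side b).
move=> /andP[/andP[_ sb]] /IH /=.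
by case: (side b) sb; case: (side b') => //= _ /andP[]; lia.
Qed.

Hypotheses (k2 : 2 <= k) (h0 : 0 < h) (hm : 3 * h <= m).
Hypothesis Ek : {in E, forall S : {set V}, #|S| = k}.
Hypothesis dA : {in e &, forall c d, c != d -> [disjoint A c & A d]}.
Hypothesis hf : hole_free E h e A.
Hypotheses (ue : u \in e) (we : w \in e) (uw : u != w).
Hypotheses (Au : m <= #|A u|) (Aw : m <= #|A w|).
Hypothesis Ac : {in e :\ u :\ w, forall c, 2 * m <= #|A c|}.

Let L (s : bool) := if s then w else u.

(** A block spends one vertex in one of the two link clusters and at most one in every other
    cluster. With alternating sides, a link cluster is used up at half the rate of the others, which
    matches the sizes [m] and [2 * m]. *)
Definition valid_block (b : seq V) : Prop :=
  [/\ size b = k.-1, uniq b,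
      if b is y :: _ then y \in A (L (side b)) else false,
      forall z, z \in behead b -> exists2 c, c \in e :\ u :\ w & z \in A c &
      {in e :\ u :\ w, forall c, count [in A c] (behead b) <= 1}].

Lemma side_disj s z : z \in A (L s) -> (z \in A w) = s.
Proof.
case: s => //= zu; apply/negP => zw.
have /pred0P/(_ z)/= := dA ue we uw.
by rewrite zu zw.
Qed.

Let Le s : L s \in e. Proof. by case: s. Qed.
Let LNL s : L s != L (~~ s). Proof. by case: s; rewrite //= eq_sym. Qed.

Lemma interior_disj c s z : c \in e :\ u :\ w -> z \in A (L s) -> z \notin A c.
Proof.
rewrite !inE => /and3P[cw cu ce] zs; apply/negP => zc.
have cL : c != L s by case: s {zs}.
have /pred0P/(_ z)/= := dA ce (Le s) cL.
by rewrite zc zs.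
Qed.

Lemma eLE s c : c \in e -> [\/ c = L s, c = L (~~ s) | c \in e :\ u :\ w].
Proof.
move=> ce; case: (eqVneq c w) => [->|cw].
  by case: s; [constructor 1 | constructor 2].
case: (eqVneq c u) => [->|cu]; first by case: s; [constructor 2|constructor 1].
by constructor 3; rewrite !inE cw cu.
Qed.

Lemma valid_cat_count s (bs : seq (seq V)) : (forall b, b \in bs -> valid_block b) ->
  count [in A (L s)] (flatten bs) = count (fun b => side b == s) bs.
Proof.
elim: bs => [//|b bs IH] vb /=.
rewrite count_cat IH => [|b' b'bs]; last by apply: vb; rewrite inE b'bs orbT.
congr (_ + _).
have [_ _] := vb b (mem_head _ _).
case: b {vb} => [//|y I] /= yL hI _.
suff -> : count [in A (L s)] I = 0.
  rewrite addn0 /=; case: eqP => [<-|ne]; first by rewrite yL.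
  case: (boolP (y \in A (L s))) => // yA.
  by case: ne; rewrite (side_disj yA).
apply/eqP; rewrite -leqn0 leqNgt -has_count -all_predC; apply/allP => z zI.
have [c ce zc] := hI z zI; apply/negP => /= zs.
by move: (interior_disj ce zs); rewrite zc.
Qed.

Lemma valid_interior_count c (bs : seq (seq V)) : c \in e :\ u :\ w ->
  (forall b, b \in bs -> valid_block b) ->
  count [in A c] (flatten bs) <= size bs.
Proof.
move=> ce; elim: bs => [//|b bs IH] vb /=.
rewrite count_cat -add1n leq_add //; last first.
  by apply: IH => b' b'bs; apply: vb; rewrite inE b'bs orbT.
have [_ _] := vb b (mem_head _ _).
case: b {vb} => [//|y I] /= yL hI cI.
have /negPf/= -> := interior_disj ce yL.
by rewrite add0n; exact: cI.
Qed.

Lemma card_heads s (p : seq (seq V)) :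
  (forall b, b \in p -> valid_block b) -> uniq (flatten p) ->
  count (fun b => side b == s) p <= #|heads p :&: A (if s then w else u)|.
Proof.
move=> vp up; rewrite -/(L s) -valid_cat_count // -size_filter.
rewrite -(card_uniqP (filter_uniq _ up)); apply/subset_leq_card/subsetP => x.
rewrite mem_filter !inE => /andP[xA /flattenP[b bp xb]].
rewrite xA andbT mem_pmap; apply/mapP; exists b => //.
have [_ _ _ hI _] := vp b bp.
case: b xb hI {bp} => [//|y I] /=; rewrite inE => /orP[/eqP-> //|xI] hI.
have [c ce xc] := hI x xI.
by move: (interior_disj ce xA); rewrite xc.
Qed.

(** Hole-freeness is applied to [X] and to the unvisited parts of the other clusters, which by
    assumption still have [h] vertices. *)
Lemma find_block s (X : {set V}) (vis : seq V) :
  X \subset A (L s) -> h <= #|X| ->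
  h + count [in A (L (~~ s))] vis <= #|A (L (~~ s))| ->
  {in e :\ u :\ w, forall c, h + count [in A c] vis <= #|A c|} ->
  uniq vis ->
  exists x b, [/\ x \in X, valid_block b, side b = ~~ s, linked E b [:: x] &
                ~~ has [in vis] b].
Proof.
move=> XA hX hL hc uv.
pose B c := if c == L s then X else A c :\: [set z in vis].
have cB c : h + count [in A c] vis <= #|A c| -> h <= #|A c :\: [set z in vis]|.
  rewrite cardsD => H.
  suff : #|A c :&: [set z in vis]| <= count [in A c] vis by lia.
  rewrite -size_filter -(card_uniqP (filter_uniq _ uv)).
  apply/subset_leq_card/subsetP => z; rewrite !inE mem_filter => /andP[-> ->] //.
have [||x [y [I [[xB yB] [sI uI] hI cI lk]]]] :=
  @hole_free_block T V E k h e A B (L s) (L (~~ s)) Ek dA hf (Le s) (Le _) (LNL s).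
- by move=> c ce; rewrite /B; case: eqP => [->|_] //; exact: subsetDl.
- move=> c ce; rewrite /B; case: eqP => [//|cL]; apply: cB.
  by have [/cL//|->//|/hc] := eLE s ce.
have ec : e :\ L s :\ L (~~ s) = e :\ u :\ w.
  by case: (s) => //=; rewrite setDDl setUC -setDDl.
rewrite ec in hI cI.
have NL c : c \in e :\ u :\ w -> c != L s.
  by rewrite !inE => /and3P[]; case: (s).
move: xB yB; rewrite {1 2}/B eqxx eq_sym (negPf (LNL s)) !inE => xX /andP[yv yA].
have sy : side (y :: I) = ~~ s by exact: side_disj yA.
exists x, (y :: I); split=> //.
- split; rewrite ?sy //=.
  + by move: sI; case: k k2 => [|[|?]] //= _ [->].
  + move=> z /hI[c ce]; rewrite /B (negPf (NL c ce)) inE => /andP[_ zA].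
    by exists c.
  + move=> c ce; rewrite (leq_trans _ (cI c ce)) // /B (negPf (NL c ce)).
    rewrite leq_eqVlt; apply/orP; left; apply/eqP/eq_in_count => z zI /=.
    have [d de] := hI z zI; rewrite /B (negPf (NL d de)) !inE => /andP[zv _].
    by rewrite zv.
- rewrite /= negb_or yv /= -all_predC; apply/allP => z /hI[c ce].
  by rewrite /B (negPf (NL c ce)) !inE => /andP[].
Qed.

(** No extension of an abandoned block avoids the visited vertices. Paths grow at the front of the
    list, so an extension [b'] precedes [b]. *)
Let dead (p pb : seq (seq V)) := forall b b', b \in pb -> valid_block b' ->
  side b' != side b -> linked E b' b -> has [in flatten (p ++ pb)] b'.

Let state (p pb : seq (seq V)) :=
  [/\ forall b, b \in p ++ pb -> valid_block b, uniq (flatten (p ++ pb)),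
      sorted alternating p & dead p pb].

Let few (pb : seq (seq V)) := forall s, count (fun b => side b == s) pb < h.

Let size_state p pb : state p pb -> size p + size pb <= #|V|.
Proof.
move=> [vb ub _ _]; rewrite -size_cat.
apply: leq_trans (_ : size (flatten (p ++ pb)) <= _); last first.
  by rewrite -(card_uniqP ub) max_card.
elim: (p ++ pb) vb {ub} => [//|b bs IH] vb /=.
rewrite size_cat -add1n leq_add //; last first.
  by apply: IH => b' b'bs; apply: vb; rewrite inE b'bs orbT.
by have [->] := vb b (mem_head _ _); move: k2; case: k => [|[]].
Qed.

Let few_size pb : few pb -> size pb + 2 <= 2 * h.
Proof.
move=> f; have := f true; have := f false.
have -> : count (fun b => side b == true) pb = count side pb.
  by apply: eq_count => b /=; rewrite eqb_id.
have -> : count (fun b => side b == false) pb = count (predC side) pb.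
  by apply: eq_count => b /=; rewrite eqbF_neg.
by have := count_predC side pb; lia.
Qed.

(** If the path were short, the clusters other than that of side [s] would all keep [h] unvisited
    vertices, and one of the [h] abandoned heads on side [s] would have an unvisited extension. *)
Let dead_end p pb s : state p pb -> h <= count (fun b => side b == s) pb ->
  count (fun b => side b == ~~ s) pb < h -> size pb < 2 * h ->
  2 * m <= size p + 5 * h.
Proof.
move=> [vb ub srt dd] hs hns spb; rewrite leqNgt; apply/negP => lt.
have vpb b : b \in pb -> valid_block b.
  by move=> bpb; apply: vb; rewrite mem_cat bpb orbT.
have vp b : b \in p -> valid_block b.
  by move=> bpb; apply: vb; rewrite mem_cat bpb.
have upb : uniq (flatten pb) by move: ub; rewrite flatten_cat cat_uniq => /and3P[].
pose X := [set z in flatten pb] :&: A (L s).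
have [||||x [b' [xX vb' sb' lk nh]]] := @find_block s X (flatten (p ++ pb)) _ _ _ _ ub.
- exact: subsetIr.
- have -> : #|X| = count [in A (L s)] (flatten pb).
    rewrite -size_filter -(card_uniqP (filter_uniq _ upb)).
    by apply: eq_card => z; rewrite !inE mem_filter andbC.
  by rewrite valid_cat_count.
- rewrite valid_cat_count // count_cat.
  have [c1 c2] := count_alternating srt.
  have cs : 2 * count (fun b => side b == ~~ s) p <= size p + 1.
    have := count_predC side p; case: (s) => /=.
      have -> : count (fun b => side b == false) p = count (predC side) p.
        by apply: eq_count => b /=; rewrite eqbF_neg.
      by lia.
    have -> : count (fun b => side b == true) p = count side p.
      by apply: eq_count => b /=; rewrite eqb_id.
    by lia.
  have : m <= #|A (L (~~ s))| by case: (s).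
  by lia.
- move=> c ce; apply: leq_trans (Ac ce).
  apply: leq_trans (leq_add (leqnn h) (valid_interior_count ce vb)) _.
  by rewrite size_cat; lia.
move: xX; rewrite !inE => /andP[/flattenP[b bpb xb] xA].
have [_ _ hb hI _] := vpb b bpb.
have eb : ohead b = Some x.
  case: b bpb xb hb hI => [//|y I] /= bpb; rewrite inE => /orP[/eqP-> //|xI] _ hI.
  have [c ce xc] := hI x xI.
  by move: (interior_disj ce xA); rewrite xc.
have sb : side b = s.
  by case: b eb {bpb xb hb hI} => [//|y I] [->]; exact: side_disj.
have lb : linked E b' b by rewrite (@linked_head _ _ _ b [:: x]).
have := dd b b' bpb vb' _ lb.
by rewrite sb sb' (negPf nh); case: (s) => /(_ isT).
Qed.

(* Depth-first search: the blocks [pb] of abandoned tips stay visited, so that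
   abandoned tips never regain an extension; each step increases
   [2 * size pb + size p]. *)
Lemma long_alternating_path :
  exists p : seq (seq V),
    [/\ forall b, b \in p -> valid_block b, uniq (flatten p), sorted alternating p & 2 * m <= size p + 5 * h].
Proof.
have [//|no] := pselect (exists p : seq (seq V), [/\ forall b, b \in p -> valid_block b,
  uniq (flatten p), sorted alternating p & 2 * m <= size p + 5 * h]).
(* Otherwise the search would never stop, while the disjointness of the blocks bounds the potential
   by [2 * #|V|]. *)
suff H N : exists p pb, [/\ state p pb, few pb & N <= 2 * size pb + size p].
  have [p [pb [st fw]]] := H (2 * #|V| + 1).
  by have := size_state st; lia.
elim: N => [|N [p [pb [st fw le]]]].
  by exists [::], [::]; split=> //; split.
have [vb ub srt dd] := st.
have fs := few_size fw.
(* When the path is empty the search restarts; the vertex [x] in [A u] only serves to produce a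
   block and is not kept. *)
case: p => [|b p] in st vb ub srt dd le *.
  have [||||x [b' [xX vb' sb' lk nh]]] :=
      @find_block false (A u :\: [set z in flatten pb]) (flatten pb) _ _ _ _ ub.
  - exact: subsetDl.
  - rewrite cardsD; suff : #|A u :&: [set z in flatten pb]| <= h by lia.
    apply: leq_trans (ltnW (fw false)); rewrite -(valid_cat_count false) //.
    rewrite -size_filter -(card_uniqP (filter_uniq _ ub)).
    by apply/subset_leq_card/subsetP => z; rewrite !inE mem_filter => /andP[-> ->].
  - by rewrite valid_cat_count //; have := fw true => /=; lia.
  - move=> c ce; apply: leq_trans (Ac ce).
    apply: leq_trans (leq_add (leqnn h) (valid_interior_count ce vb)) _.
    by rewrite cat0s; lia.
  have ub' : uniq (flatten ((b' :: [::]) ++ pb)).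
    by rewrite /= cat_uniq ub andbT has_sym nh andbT; case: vb'.
  exists [:: b'], pb; split=> //=; last by move: le => /=; lia.
  split=> // [b|b b1 bpb v1 s1 l1].
    by rewrite /= inE => /orP[/eqP-> //|]; exact: vb.
  have /hasP[z zb1 zf] := dd b b1 bpb v1 s1 l1.
  by apply/hasP; exists z => //=; rewrite mem_cat [z \in flatten pb]zf orbT.
have [[b' [vb' sb' lk nh]]|stuck] := pselect (exists b', [/\ valid_block b',
    side b' != side b, linked E b' b & ~~ has [in flatten ((b :: p) ++ pb)] b']).
  exists (b' :: b :: p), pb; split=> //=; last by move: le => /=; lia.
  split=> [b1||//|b1 b2 bpb v1 s1 l1].
  - by rewrite cat_cons inE => /orP[/eqP-> //|]; exact: vb.
  - rewrite cat_cons /= cat_uniq; move: ub => /= ->; rewrite andbT has_sym nh andbT.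
    by case: vb'.
  - by rewrite /= /alternating lk sb' /=; exact: srt.
  - have /hasP[z zb1 zf] := dd b1 b2 bpb v1 s1 l1.
    by apply/hasP; exists z => //=; rewrite mem_cat [z \in b ++ _]zf orbT.
have pe : perm_eq (p ++ b :: pb) ((b :: p) ++ pb).
  by rewrite -cat1s perm_catCA.
have me : flatten (p ++ b :: pb) =i flatten ((b :: p) ++ pb).
  by apply: perm_mem; exact: perm_flatten.
have st' : state p (b :: pb).
  split=> [b1||| b1 b2].
  - by rewrite (perm_mem pe); exact: vb.
  - by rewrite (perm_uniq (perm_flatten pe)).
  - by move: srt => /= /path_sorted.
  - rewrite inE => /orP[/eqP->|b1pb] v2 s2 l2.
      rewrite (eq_has (a2 := [in flatten ((b :: p) ++ pb)])) //.
      by apply/negPn/negP => nh; apply: stuck; exists b2.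
    rewrite (eq_has (a2 := [in flatten ((b :: p) ++ pb)])) //.
    exact: dd l2.
(* Abandoning [b] raises the count of its own side only, so [dead_end] applies as soon as that count
   reaches [h]. *)
have [hc|hc] := leqP h (count (fun b' => side b' == side b) (b :: pb)).
  case: no; exists p; split.
  - by move=> b1 b1p; apply: vb; rewrite inE mem_cat b1p orbT.
  - by move: ub; rewrite /= flatten_cat !cat_uniq => /and3P[_ _ /and3P[]].
  - by move: srt => /= /path_sorted.
  - apply: (@dead_end p (b :: pb) (side b)) => //=; last by lia.
    rewrite (_ : side b == ~~ side b = false) ?add0n //.
    by case: (side b).
exists p, (b :: pb); split=> //; last by move: le => /=; lia.
move=> s; case: (eqVneq (side b) s) => [<- //|ns] /=.
by rewrite (negPf ns) add0n; exact: fw.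
Qed.
End LongPath.

(** * Connecting paths *)

Section Distance.
Variables (T : finType) (adj : rel T) (a0 : T).

Let reach a n := [exists p : n.-tuple T, path adj a0 p && (last a0 p == a)].

(* The distance of an unreachable vertex is the junk value [#|T|]. *)
Definition dist (a : T) : nat := find (reach a) (iota 0 #|T|).

Lemma dist_le_card a : dist a <= #|T|.
Proof. by rewrite -[leqRHS](size_iota 0) find_size. Qed.

Lemma dist_le p : path adj a0 p -> dist (last a0 p) <= size p.
Proof.
move=> hp; have [lt|] := ltnP (size p) #|T|; last exact: leq_trans (dist_le_card _).
rewrite leqNgt; apply/negP => /(before_find 0).
rewrite nth_iota // add0n => /negbT/existsP[]; exists (in_tuple p).
by rewrite /= hp eqxx.
Qed.

Lemma distP a : connect adj a0 a ->
  exists p, [/\ path adj a0 p, last a0 p = a & size p = dist a].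
Proof.
case/connectP => p0 hp0 ->; case: (shortenP hp0) => p hp up _.
have hr : has (reach (last a0 p)) (iota 0 #|T|).
  apply/hasP; exists (size p).
    by rewrite mem_iota /= add0n -[(size p).+1]/(size (a0 :: p)) -(card_uniqP up)
      max_card.
  by apply/existsP; exists (in_tuple p); rewrite /= hp eqxx.
have := nth_find 0 hr; rewrite nth_iota ?add0n; last first.
  by rewrite -[ltnRHS](size_iota 0) -has_find.
case/existsP => q /andP[hq /eqP lq]; exists q; split=> //.
by rewrite size_tuple.
Qed.

Lemma dist_adj a b : connect adj a0 a -> adj a b -> dist b <= (dist a).+1.
Proof.
move=> /distP[p [hp lp <-]] ab.
have := @dist_le (rcons p b); rewrite last_rcons size_rcons; apply.
by rewrite rcons_path hp lp.
Qed.

Lemma dist_pred a n : connect adj a0 a -> dist a = n.+1 ->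
  exists b, [/\ connect adj a0 b, adj b a & dist b = n].
Proof.
move=> ca; have [p [hp lp sp]] := distP ca => da; move: hp lp sp.
rewrite da; case/lastP: p => [//|p b]; rewrite rcons_path last_rcons size_rcons.
move=> /andP[hp ab] eb [sp]; subst b.
have cb : connect adj a0 (last a0 p) by apply/connectP; exists p.
exists (last a0 p); split=> //; apply/eqP; rewrite eqn_leq.
by rewrite -{1}sp dist_le //= -ltnS -da dist_adj.
Qed.
End Distance.

(** Unlike [shadow], this also relates a covered vertex to itself, which spares case distinctions
    when two clusters of one edge are compared. *)
Definition adjacent (T : finType) (H : {set {set T}}) : rel T :=
  fun x y => [exists e in H, (x \in e) && (y \in e)].

Section Connector.
Variables (T V : finType) (E : {set {set V}}) (k h : nat).
Variables (H : {set {set T}}) (U : T -> {set V}) (Rv : bool -> T -> {set V}).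
Hypothesis k2 : 2 <= k.
Hypothesis Ek : {in E, forall S : {set V}, #|S| = k}.
Hypothesis dU : forall a b, a != b -> [disjoint U a & U b].
Hypothesis hfH : forall e, e \in H -> hole_free E h e U.
Hypothesis RvU : forall s b, Rv s b \subset U b.
Hypothesis dR : forall b, [disjoint Rv false b & Rv true b].
Hypothesis cardR : forall s b, b \in cover H -> 2 * h <= #|Rv s b|.
Variables (a0 : T) (X : {set V}).
Hypotheses (XU : X \subset U a0) (hX : h <= #|X|).

Let d := dist (adjacent H) a0.

Lemma U_inj a b z : z \in U a -> z \in U b -> a = b.
Proof.
move=> za zb; apply/eqP/negPn/negP => ab.
by have /pred0P/(_ z)/= := dU ab; rewrite za zb.
Qed.

(* Step [i] of a connecting path uses the reserve half of parity [i] in clusters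
   at distance [i - 1] or [i] from [a0], so that distinct steps use disjoint
   sets however long the path is. *)
Let layer i z := exists2 c, (d c == i) || (d c == i.-1) & z \in Rv (odd i) c.

Let layer_disj i j z : 0 < i -> i < j -> layer i z -> layer j z -> False.
Proof.
move=> i0 ij [c dc zc] [c' dc' zc'].
have ecc := U_inj (subsetP (RvU _ _) _ zc) (subsetP (RvU _ _) _ zc').
subst c'; have [oij|oij] := eqVneq (odd i) (odd j).
  have ij1 : j != i.+1 by apply/eqP => ej; move: oij; rewrite ej /=; case: (odd i).
  by move: dc dc' => /orP[]/eqP-> /orP[]/eqP; lia.
have /pred0P/(_ z)/= := dR c.
by move: zc zc' oij; case: (odd i); case: (odd j) => // -> ->.
Qed.

(** Every cluster of an edge containing clusters at distances [n] and [n.+1] is itself at distance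
    [n] or [n.+1], so the interior vertices fall into layer [n.+1]. *)
Let step n e a' a (Y' Y : {set V}) : e \in H -> a' \in e -> a \in e ->
  connect (adjacent H) a0 a' -> d a' = n -> d a = n.+1 ->
  Y' \subset U a' -> h <= #|Y'| -> Y \subset U a -> h <= #|Y| ->
  exists x y I, [/\ x \in Y' /\ y \in Y, linked E (y :: I) [:: x],
    (size I).+2 = k, uniq (y :: I) & forall z, z \in I -> layer n.+1 z].
Proof.
move=> eH a'e ae ca' da' da Y'U hY' YU hY.
have aa' : a' != a by apply/eqP => ea; move: da; rewrite -ea da'; lia.
pose B c := if c == a' then Y' else if c == a then Y else Rv (odd n.+1) c.
have dU' : {in e &, forall c b, c != b -> [disjoint U c & U b]}.
  by move=> c b _ _; exact: dU.
have adj c c' : c \in e -> c' \in e -> adjacent H c c'.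
  by move=> ce c'e; apply/existsP; exists e; rewrite eH ce.
have [||x [y [I [[xB yB] [sI uI] hI _ lk]]]] :=
  @hole_free_block T V E k h e U B a' a Ek dU' (hfH eH) a'e ae aa'.
- by move=> c ce; rewrite /B; case: eqP => [->//|_]; case: eqP => [->//|_].
- move=> c ce; rewrite /B; case: eqP => [//|_]; case: eqP => [//|_].
  apply: leq_trans (leq_pmull h (isT : 0 < 2)) (cardR _ _).
  by apply/bigcupP; exists e.
move: xB yB; rewrite /B eqxx eq_sym (negPf aa') eqxx => xY' yY.
exists x, y, I; split=> // z /hI[c]; rewrite !inE => /and3P[cb ca ce].
rewrite /B (negPf ca) (negPf cb) => zc; exists c => //=.
have cc : connect (adjacent H) a0 c.
  by apply: connect_trans ca' _; apply: connect1; exact: adj.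
have := dist_adj ca' (adj _ _ a'e ce); rewrite -/d da' leq_eqVlt => /orP[->//|].
rewrite ltnS => dc; apply/orP; right; rewrite eqn_leq dc /=.
by have := dist_adj cc (adj _ _ ce ae); rewrite -/d da ltnS.
Qed.

(** The last edge can only be required to start in a set of [h] vertices, so the induction needs [h]
    reachable vertices in the reserve of the previous cluster. There are that many: otherwise the
    unreachable part of this reserve of size [2 * h] would have at least [h] vertices, and the
    induction hypothesis would reach one of them. *)
Let connector n a (Y : {set V}) : connect (adjacent H) a0 a -> d a = n.+1 ->
  Y \subset U a -> h <= #|Y| ->
  (forall i z, 0 < i <= n -> z \in Y -> ~ layer i z) ->
  exists x y I cs, [/\ x \in X /\ y \in Y,
    path (linked E) (y :: I) (rcons cs [:: x]),
    all (fun b => size b == k.-1) ((y :: I) :: cs) /\ size cs <= n,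
    uniq (flatten ((y :: I) :: cs)) &
    forall z, z \in I ++ flatten cs -> exists2 i, 0 < i <= n.+1 & layer i z].
Proof.
elim: n a Y => [|n IH] a Y ca da YU hY dY; have [b [cb ba db]] := dist_pred ca da;
  rewrite -/d in db;
  case/existsP: ba => e /andP[eH /andP[be ae]].
  have eb : b = a0.
    have [p [_ lp]] := distP cb; rewrite -/d db => /size0nil ep.
    by rewrite -lp ep.
  rewrite {b}eb in cb be db *.
  have [x [y [I [[xX yY] lk sI uI lI]]]] := step eH be ae cb db da XU hX YU hY.
  exists x, y, I, [::]; split=> //.
  - by move: lk; rewrite /= andbT.
  - by rewrite -sI /= eqxx.
  - by rewrite /= cats0.
  - by move=> z; rewrite cats0 => /lI lz; exists 1.
pose reachable y := exists x I cs, [/\ x \in X,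
    path (linked E) (y :: I) (rcons cs [:: x]),
    all (fun b => size b == k.-1) ((y :: I) :: cs) /\ size cs <= n,
    uniq (flatten ((y :: I) :: cs)) &
    forall z, z \in I ++ flatten cs -> exists2 i, 0 < i <= n.+1 & layer i z].
pose N := Rv (odd n.+1) b.
pose Y' := [set y in N | `[< reachable y >]].
have Nlayer y : y \in N -> layer n.+1 y by move=> yN; exists b; rewrite // db eqxx.
have hY' : h <= #|Y'|.
  rewrite leqNgt; apply/negP => ltY'.
  have hN : 2 * h <= #|N| by apply: cardR; apply/bigcupP; exists e.
  have [||i z /andP[i0 iln] |x [y [I [cs [[xX yY] p sz u l]]]]] :=
    IH b (N :\: Y') cb db.
  - by apply: subset_trans (subsetDl _ _) (RvU _ _).
  - rewrite cardsD; have : #|N :&: Y'| <= #|Y'| by rewrite subset_leq_card // subsetIr.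
    by lia.
  - rewrite inE => /andP[_ /Nlayer lz] liz.
    exact: (@layer_disj i n.+1 z).
  move: yY; rewrite inE => /andP[/negP ny yN]; apply: ny; rewrite inE yN /=.
  by apply/asboolP; exists x, I, cs.
have Y'U : Y' \subset U b.
  by apply: subset_trans (RvU (odd n.+1) b); apply/subsetP => z; rewrite inE => /andP[].
have [y' [y [I [[y'Y' yY] lk sI uI lI]]]] := step eH be ae cb db da Y'U hY' YU hY.
move: y'Y'; rewrite inE => /andP[y'N /asboolP[x [I' [cs [xX p sz u l]]]]].
have lay z : z \in flatten ((y' :: I') :: cs) -> exists2 i, 0 < i <= n.+1 & layer i z.
  rewrite /= inE => /orP[/eqP->|]; last exact: l.
  by exists n.+1; [rewrite /= leqnn | exact: Nlayer].
exists x, y, I, ((y' :: I') :: cs); split=> //.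
- by move: lk p => /= ->.
- case: sz => sz szn; split; last by rewrite /= ltnS.
  by rewrite -sI; apply/andP; split; [exact: eqxx | rewrite sI].
- have -> : flatten ((y :: I) :: (y' :: I') :: cs) =
      (y :: I) ++ flatten ((y' :: I') :: cs) by [].
  rewrite cat_uniq uI u andbT andTb; apply/hasPn => z /lay[i il li].
  rewrite inE negb_or; apply/andP; split.
    by apply/eqP => ez; apply: (dY i z) => //; rewrite ez.
  apply/negP => /lI lz; case/andP: il => i0 il.
  exact: (@layer_disj i n.+2 z).
- move=> z; rewrite mem_cat => /orP[/lI lz|/lay[i il li]].
    by exists n.+2 => //=.
  exists i => //; case/andP: il => -> /= il; exact: leqW.
Qed.

Lemma connect_sets a (Y : {set V}) : connect (adjacent H) a0 a -> a != a0 ->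
  Y \subset U a -> h <= #|Y| -> (forall s c, [disjoint Y & Rv s c]) ->
  exists x y I cs, [/\ x \in X /\ y \in Y,
    path (linked E) (y :: I) (rcons cs [:: x]),
    all (fun b => size b == k.-1) ((y :: I) :: cs) /\ size cs < #|T|,
    uniq (flatten ((y :: I) :: cs)) &
    forall z, z \in I ++ flatten cs -> exists s c, z \in Rv s c].
Proof.
move=> ca aa0 YU hY dY; case da : (d a) => [|n].
  have [p [_ lp]] := distP ca; rewrite -/d da => /size0nil ep.
  by move: lp aa0; rewrite ep /= => ->; rewrite eqxx.
have [|x [y [I [cs [xy p [sz szn] u l]]]]] := connector ca da YU hY.
  move=> i z _ zY [c _ zc].
  by have /pred0P/(_ z)/= := dY (odd i) c; rewrite zY zc.
exists x, y, I, cs; split=> //.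
  split=> //; apply: leq_ltn_trans szn _.
  by rewrite -da; exact: dist_le_card.
by move=> z /l[i _ [c _ zc]]; exists (odd i), c.
Qed.
End Connector.

(** * Joining the paths into a cycle *)

Lemma linked_cat (V : finType) (E : {set {set V}}) (p q r : seq (seq V)) b c :
  ohead c = ohead b -> sorted (linked E) (p ++ b :: q) ->
  sorted (linked E) (c :: r) -> sorted (linked E) (p ++ c :: r).
Proof.
move=> bc; case: p => [//|a p] /=; rewrite !cat_path /= => /andP[-> /andP[lb _]].
by rewrite (@linked_head _ _ _ c b) // lb.
Qed.

Lemma size_flatten_blocks (V : finType) (n : nat) (p : seq (seq V)) :
  all (fun b => size b == n) p -> size (flatten p) = size p * n.
Proof.
by elim: p => [//|b p IH] /= /andP[/eqP sb /IH sp]; rewrite size_cat sb sp mulSn.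
Qed.

Lemma headsP (V : finType) (p : seq (seq V)) x : x \in heads p ->
  exists p1 b p2, p = p1 ++ b :: p2 /\ ohead b = Some x.
Proof.
rewrite inE mem_pmap => /mapP[b /splitPr[p1 p2] hb].
by exists p1, b, p2.
Qed.

Lemma flatten_cons (A : Type) (a : seq A) (s : seq (seq A)) :
  flatten (a :: s) = a ++ flatten s.
Proof. by []. Qed.

Lemma path_rcons_cat (A : Type) (e : rel A) x y s t :
  path e x (rcons s y) -> path e y t -> path e x (s ++ y :: t).
Proof. by rewrite -cat_rcons cat_path last_rcons => -> ->. Qed.

Lemma ohead_mem (V : eqType) (b : seq V) x : ohead b = Some x -> x \in b.
Proof. by case: b => [//|y b] [->]; rewrite mem_head. Qed.

(* The two link clusters of a cluster edge [z] are its first and last entries.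
   Its path uses the half [s] of the clusters in [slot k s z], hence one half of
   each link cluster, the other half being left to the adjacent edge. *)
Definition slot (T : Type) (k : nat) (s : bool) (z : seq T) : seq T :=
  if s then behead z else take k.-1 z.

Section Assembly.
Variables (T V : finType) (E : {set {set V}}) (k h m : nat) (x0 : T).
Variables (H : {set {set T}}) (U : T -> {set V}) (Hf Rv : bool -> T -> {set V}).
Hypotheses (k2 : 2 <= k) (h0 : 0 < h) (hm : 5 * h <= m).
Hypothesis Ek : {in E, forall S : {set V}, #|S| = k}.
Hypothesis dU : forall a b, a != b -> [disjoint U a & U b].
Hypothesis hfH : forall e, e \in H -> hole_free E h e U.
Hypothesis HfU : forall s b, Hf s b \subset U b.
Hypothesis RvU : forall s b, Rv s b \subset U b.
Hypothesis dR : forall b, [disjoint Rv false b & Rv true b].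
Hypothesis dHf : forall b, [disjoint Hf false b & Hf true b].
Hypothesis dHR : forall s s' b, [disjoint Hf s b & Rv s' b].
Hypothesis cardH : forall s b, b \in cover H -> m <= #|Hf s b|.
Hypothesis cardR : forall s b, b \in cover H -> 3 * h <= #|Rv s b|.
Hypothesis conn : {in cover H &, forall a b, connect (adjacent H) a b}.

Let Rall : {set V} := [set v | [exists s : bool, [exists c, v \in Rv s c]]].

(** The vertices allotted to the path of the cluster edge [z]. Recording the half [s] makes the
    regions of cluster edges with disjoint slots disjoint, although the edges share link
    clusters. *)
Let in_region z v := exists s c, c \in slot k s z /\ v \in Hf s c.

Let good z := [/\ size z = k, uniq z & [set c in z] \in H].

Let blocks (p : seq (seq V)) := all (fun b => size b == k.-1) p.

Let Uinj a b z : z \in U a -> z \in U b -> a = b.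
Proof. exact: (U_inj dU). Qed.

Let region_Rall z v : in_region z v -> v \notin Rall.
Proof.
move=> [s [c [_ vc]]]; apply/negP; rewrite inE => /existsP[s' /existsP[c' vc']].
have ec := Uinj (subsetP (HfU _ _) _ vc) (subsetP (RvU _ _) _ vc').
by subst c'; have /pred0P/(_ v)/= := dHR s s' c; rewrite vc vc'.
Qed.

Let good_cover z c : good z -> c \in z -> c \in cover H.
Proof. by move=> [_ _ zH] cz; apply/bigcupP; exists [set c in z] => //; rewrite inE. Qed.

Let good_shape z : good z ->
  exists i, z = head x0 z :: rcons i (last x0 z) /\ take k.-1 z = head x0 z :: i.
Proof.
move=> [sz _ _]; case: z sz => [|u z] sz; first by move: k2; rewrite -sz.
case/lastP: z sz => [|i w] sz; first by move: k2; rewrite -sz.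
exists i => /=; rewrite last_rcons; split=> //.
rewrite -sz /= size_rcons /=; congr (_ :: _).
by rewrite -cats1 take_size_cat.
Qed.

(** The first and the last [2 * h] blocks of a long path are set apart as landing zones: since sides
    alternate, each zone has [h] heads in either link cluster. Their [4 * h] blocks are added to the
    loss of [5 * h] from the search. *)
Let segment z : good z -> exists top mid bot, let p := top ++ mid ++ bot in
  [/\ (forall v, v \in flatten p -> in_region z v), blocks p /\ uniq (flatten p),
      sorted (linked E) p, 2 * m <= size mid + 9 * h &
      forall c, c \in [:: head x0 z; last x0 z] ->
        h <= #|heads top :&: U c| /\ h <= #|heads bot :&: U c|].
Proof.
move=> gz; have [i [ez tz]] := good_shape gz.
have [sz uz zH] := gz.
set u := head x0 z in ez tz *; set w := last x0 z in ez *.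
pose A c := (if c \in slot k false z then Hf false c else set0) :|:
            (if c \in slot k true z then Hf true c else set0).
have uz' := uz; rewrite ez /= rcons_uniq mem_rcons inE negb_or in uz'.
case/andP: uz' => /andP[uw ui] /andP[wi _].
have slF c : (c \in slot k false z) = (c == u) || (c \in i).
  by rewrite /slot tz inE.
have slT c : (c \in slot k true z) = (c == w) || (c \in i).
  by rewrite /slot ez /= mem_rcons inE.
have AU c : A c \subset U c.
  by rewrite subUset; do 2!case: ifP; rewrite ?sub0set ?HfU.
have zE c : (c \in [set c in z]) = [|| c == u, c == w | c \in i].
  by rewrite inE ez inE mem_rcons inE.
have cH c : c \in [set c in z] -> c \in cover H.
  by move=> cz; apply/bigcupP; exists [set c in z].
have Areg c v : v \in A c -> in_region z v.
  rewrite inE => /orP[]; case: ifP => [cs vc|]; rewrite ?inE //.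
    by exists false, c.
  by exists true, c.
have Au : A u = Hf false u.
  by rewrite /A slF slT eqxx (negPf uw) (negPf ui) setU0.
have Aw : A w = Hf true w.
  by rewrite /A slF slT eqxx eq_sym (negPf uw) (negPf wi) set0U.
have ue : u \in [set c in z] by rewrite zE eqxx.
have we : w \in [set c in z] by rewrite zE eqxx orbT.
have dAz : {in [set c in z] &, forall c d, c != d -> [disjoint A c & A d]}.
  move=> c d _ _ cd; apply: disjointWl (AU c) _; apply: disjointWr (AU d) _.
  exact: dU.
have hm3 : 3 * h <= m by clear -hm; lia.
have [||||p [vp up sp szp]] := @long_alternating_path T V E k h m [set c in z] A u w
    k2 h0 hm3 Ek dAz _ ue we uw.
- move=> B BA hB; apply: (hfH zH) => // c ce.
  by apply: subset_trans (AU c); exact: BA.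
- by rewrite Au; apply/cardH/cH.
- by rewrite Aw; apply/cardH/cH.
- move=> c; rewrite in_setD1 in_setD1 => /and3P[cw cu cz].
  have ci : c \in i by move: cz; rewrite zE (negPf cw) (negPf cu).
  rewrite /A slF slT ci !orbT.
  have -> : #|Hf false c :|: Hf true c| = #|Hf false c| + #|Hf true c|.
    by rewrite cardsU (disjoint_setI0 (dHf c)) cards0 subn0.
  by rewrite mul2n -addnn leq_add // cardH // cH.
have p4 : 4 * h <= size p by clear -hm szp; lia.
pose n := size p - 2 * h.
exists (take (2 * h) p), (drop (2 * h) (take n p)), (drop n p).
have ep : take (2 * h) p ++ drop (2 * h) (take n p) ++ drop n p = p.
  rewrite catA -{1}[p](cat_take_drop n) takel_cat ?cat_take_drop //.
  by rewrite size_take /n; clear -p4; case: ltnP; lia.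
have vin v : v \in flatten p -> in_region z v.
  case/flattenP => b bp vb; have [_ _ hb hI _] := vp b bp.
  case: b vb hb hI {bp} => [//|y I] /=; rewrite inE => /orP[/eqP-> /Areg //|vI] _.
  by move=> /(_ _ vI)[c _ /Areg].
have hd (q : seq (seq V)) c : size q = 2 * h -> {subset q <= p} -> uniq (flatten q) ->
    sorted (alternating E A w) q -> c \in [:: u; w] -> h <= #|heads q :&: U c|.
  move=> sq qp uq srt cuw.
  have vq b : b \in q -> valid_block k [set c in z] A u w b by move/qp/vp.
  have [c1 c2] := count_alternating srt.
  pose s := c == w.
  have hs : h <= count (fun b => side A w b == s) q.
    have := count_predC (side A w) q; case: (s) => /=.
      have -> : count (fun b => side A w b == true) q = count (side A w) q.
        by apply: eq_count => b /=; rewrite eqb_id.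
      by clear -c1 sq; lia.
    have -> : count (fun b => side A w b == false) q = count (predC (side A w)) q.
      by apply: eq_count => b /=; rewrite eqbF_neg.
    by clear -c2 sq; lia.
  apply: leq_trans hs _; apply: leq_trans (card_heads dAz ue we uw s vq uq) _.
  have -> : (if s then w else u) = c.
    move: cuw; rewrite !inE /s; case: (eqVneq c w) => [-> //|_].
    by rewrite orbF => /eqP.
  by apply/subset_leq_card/setIS/AU.
rewrite /= ep; split=> //.
- by split=> //; apply/allP => b /vp[->].
- by apply: sub_sorted sp => a b /andP[].
- by rewrite size_drop size_take /n; clear -p4 szp; case: ltnP; lia.
- move=> c cuw; split; apply: hd => //.
  + by rewrite size_take; clear -p4; case: ltnP; lia.
  + by move=> b; exact: mem_take.
  + by move: up; rewrite -{1}ep flatten_cat cat_uniq => /and3P[].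
  + exact: take_sorted.
  + by rewrite size_drop /n; clear -p4; lia.
  + by move=> b; exact: mem_drop.
  + by move: up; rewrite -{1}ep !flatten_cat !cat_uniq => /and3P[_ _ /and3P[]].
  + exact: drop_sorted.
Qed.

(** A connecting path must end in a cluster other than [a0]; having heads in both [u] and [w]
    guarantees such a choice. As at most [h] reserve vertices are used up by [B], each reserve of
    size [3 * h] still offers [2 * h]. *)
Let join a0 u w (top bot : seq (seq V)) (B : {set V}) :
  a0 \in cover H -> u \in cover H -> w \in cover H -> u != w ->
  h <= #|heads top :&: U a0| ->
  (forall c, c \in [:: u; w] -> h <= #|heads bot :&: U c|) ->
  (forall v, v \in flatten bot -> v \notin Rall) ->
  #|B :&: Rall| <= h ->
  exists t1 bx t2 b1 by' b2 cb cs,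
    [/\ top = t1 ++ bx :: t2 /\ bot = b1 ++ by' :: b2,
        ohead cb = ohead by', path (linked E) cb (rcons cs bx),
        blocks (cb :: cs) /\ size cs < #|T| &
        uniq (flatten (cb :: cs)) /\ forall v, v \in flatten (cb :: cs) ->
          ohead by' = Some v \/ v \in Rall /\ v \notin B].
Proof.
move=> a0H uH wH uw htop hbot botR hB.
have [c [cuw ca0]] : exists c, c \in [:: u; w] /\ c != a0.
  case: (eqVneq u a0) => [<-|ua]; last by exists u; rewrite inE eqxx.
  by exists w; rewrite !inE eqxx orbT eq_sym.
have cH : c \in cover H by move: cuw; rewrite !inE => /orP[]/eqP->.
have XU : heads top :&: U a0 \subset U a0 by exact: subsetIr.
pose Rv' s b := Rv s b :\: B.
have [||||x [y [I [cs [[xX yY] pth [sz szn] ucs hcs]]]]] :=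
  @connect_sets T V E k h H U Rv' k2 Ek dU hfH _ _ _ a0 _ XU htop
    c (heads bot :&: U c) (conn a0H cH) ca0 (subsetIr _ _) (hbot c cuw).
- by move=> s b; apply: subset_trans (RvU s b); exact: subsetDl.
- move=> b; apply: disjointWl (subsetDl _ _) _; apply: disjointWr (subsetDl _ _) _.
  exact: dR.
- move=> s b bH; have := cardR s bH; rewrite cardsD.
  suff : #|Rv s b :&: B| <= #|B :&: Rall| by clear -hB; lia.
  apply/subset_leq_card/subsetP => v; rewrite !inE => /andP[vR ->] /=.
  by apply/existsP; exists s; apply/existsP; exists b.
- move=> s b; apply/pred0P => v /=; apply/negP => /andP[].
  rewrite inE => /andP[/headsP[p1 [b' [p2 [eb hb]]]] _].
  rewrite inE => /andP[_ vR].
  have /botR : v \in flatten bot.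
    rewrite eb flatten_cat mem_cat; apply/orP; right.
    by rewrite /= mem_cat (ohead_mem hb).
  by rewrite inE => /negP[]; apply/existsP; exists s; apply/existsP; exists b.
move: xX yY; rewrite !in_setI => /andP[/headsP[t1 [bx [t2 [et hx]]]] _].
move=> /andP[/headsP[b1 [by' [b2 [eb hy]]]] _].
exists t1, bx, t2, b1, by', b2, (y :: I), cs; split=> //.
- move: pth; rewrite !rcons_path => /andP[-> lk].
  by rewrite -(@linked_head _ _ _ [:: x] bx).
- split=> // v; rewrite /= inE => /orP[/eqP->|/hcs[s [b]]]; first by left.
  rewrite inE => /andP[vB vR]; right; split=> //.
  by rewrite inE; apply/existsP; exists s; apply/existsP; exists b.
Qed.

(** State of the chain through [z :: Zs]. New cluster edges are attached at [top], and the cycle is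
    finally closed between [bot] and [top]; only [mid] is counted because later joinings may cut off
    blocks of the two zones. *)
Let inv z (Zs : seq (seq T)) := exists top mid bot, let p := top ++ mid ++ bot in
  [/\ blocks p /\ uniq (flatten p), sorted (linked E) p,
      h <= #|heads top :&: U (head x0 z)|,
      (forall v, v \in flatten bot -> in_region (last z Zs) v) /\
      (forall c, c \in [:: head x0 (last z Zs); last x0 (last z Zs)] ->
        h <= #|heads bot :&: U c|) &
      [/\ forall v, v \in flatten p ->
            v \in Rall \/ exists2 z', z' \in z :: Zs & in_region z' v,
          #|[set v in flatten p] :&: Rall| <= size Zs * (#|T| * k) &
          (size Zs).+1 * (2 * m) <= size mid + (size Zs).+1 * (9 * h)]].

Let head_last z : good z ->
  [/\ head x0 z \in cover H, last x0 z \in cover H & head x0 z != last x0 z].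
Proof.
move=> gz; have [i [ez _]] := good_shape gz.
split.
- by apply: (good_cover gz); rewrite {2}ez mem_head.
- by apply: (good_cover gz); rewrite {2}ez inE mem_rcons mem_head orbT.
- have [_ uz _] := gz; move: uz; rewrite {1}ez cons_uniq mem_rcons inE negb_or.
  by move=> /andP[/andP[]].
Qed.

Let flatten3 (a b c : seq (seq V)) :
  flatten (a ++ b ++ c) = flatten a ++ flatten b ++ flatten c.
Proof. by rewrite !flatten_cat. Qed.

Let size_connector cb cs : blocks (cb :: cs) -> size cs < #|T| ->
  size (flatten (cb :: cs)) <= #|T| * k.
Proof.
move=> bl szc; rewrite (size_flatten_blocks bl).
by rewrite leq_mul // leq_pred.
Qed.

(** Each new cluster edge goes in front and costs one connecting path of at most [#|T|] blocks; the
    bound by [h] thus covers the reserve vertices used by all of them, including the connection that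
    will close the cycle. *)
Let assemble z Zs : (forall z', z' \in z :: Zs -> good z') ->
  (forall s, uniq (flatten [seq slot k s z' | z' <- z :: Zs])) ->
  (size Zs).+1 * (#|T| * k) <= h -> inv z Zs.
Proof.
elim: Zs z => [|z Zs IH] z2 gZ uZ hZ; have g2 := gZ z2 (mem_head _ _);
    have [top [mid [bot [reg [bl un] srt szm hds]]]] := segment g2;
    have [h2 l2 hl2] := head_last g2.
  exists top, mid, bot; split=> //.
  - by have [] := hds _ (mem_head _ _).
  - split=> [v vb|c /hds[]//]; apply: reg.
    by rewrite flatten3 !mem_cat vb !orbT.
  - split; last by rewrite !mul1n.
      by move=> v /reg rv; right; exists z2; rewrite ?mem_head.
    rewrite leqn0 cards_eq0; apply/eqP/setP => v; rewrite in_setI !in_set.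
    apply/negP => /andP[/reg/region_Rall/negP nR vR]; apply: nR.
    by rewrite in_set.
have [|s||T1 [M1 [B1 [[bl1 un1] srt1 htop1 [regb1 hb1] [loc1 cR1 sz1]]]]] := IH z.
- by move=> z' z'Z; apply: gZ; rewrite inE z'Z orbT.
- by have := uZ s; rewrite map_cons flatten_cons cat_uniq => /and3P[].
- by apply: leq_trans hZ; rewrite leq_mul2r leqW ?orbT.
have gz : good z by apply: gZ; rewrite !inE eqxx orbT.
have [hz lz hlz] := head_last gz.
have regdisj v : in_region z2 v -> ~ exists2 z', z' \in z :: Zs & in_region z' v.
  move=> [s [c [cs vc]]] [z' z'Z [s' [c' [cs' vc']]]].
  have ec := Uinj (subsetP (HfU _ _) _ vc) (subsetP (HfU _ _) _ vc').
  subst c'; have es : s = s'.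
    apply/eqP/negPn/negP => ss'; have /pred0P/(_ v)/= := dHf c.
    by move: vc vc' ss'; case: (s); case: (s') => // -> ->.
  subst s'; have := uZ s; rewrite map_cons flatten_cons cat_uniq.
  case/and3P => _ /hasP[]; exists c => //.
  by apply/flattenP; exists (slot k s z') => //; apply: map_f.
pose P := T1 ++ M1 ++ B1.
pose B := [set v in flatten P].
have hB : #|B :&: Rall| <= h.
  apply: leq_trans cR1 (leq_trans _ hZ).
  by rewrite leq_mul2r leqW ?orbT // leqW.
have [||t1 [bx [t2 [b1 [by' [b2 [cb [cs [[et eb] hcb pcs [blc szc] [uc hc]]]]]]]]]] :=
  @join (head x0 z) (head x0 z2) (last x0 z2) T1 bot B hz h2 l2 hl2 htop1 _ _ hB.
- by move=> c /hds[].
- move=> v vb; apply: (@region_Rall z2); apply: reg.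
  by rewrite flatten3 !mem_cat vb !orbT.
(* The blocks of [T1] before [bx] and those of [bot] from [by'] on are given up; [cb] takes the
   place of [by'], having the same head. *)
pose D := (bx :: t2) ++ M1 ++ B1.
have eP : P = t1 ++ D by rewrite /P et -catA.
pose A1 := top ++ mid ++ b1.
have eS : top ++ mid ++ bot = A1 ++ by' :: b2 by rewrite eb /A1 !catA.
have DB v : v \in flatten D -> v \in B.
  by move=> vD; rewrite in_set eP flatten_cat mem_cat vD orbT.
have A1r v : v \in flatten A1 -> in_region z2 v.
  by move=> vA; apply: reg; rewrite eS flatten_cat mem_cat vA.
have by_r v : ohead by' = Some v -> in_region z2 v.
  move/ohead_mem => vb; apply: reg.
  by rewrite eS flatten_cat /= !mem_cat vb orbT.
have zB v : in_region z2 v -> v \notin B.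
  move=> rv; apply/negP; rewrite inE => /loc1[vR|]; last exact: regdisj.
  by move: (region_Rall rv); rewrite vR.
have eN : top ++ (mid ++ b1 ++ (cb :: cs) ++ (bx :: t2) ++ M1) ++ B1 =
    A1 ++ (cb :: cs) ++ D by rewrite /A1 /D !catA.
have memN v : (v \in flatten (A1 ++ (cb :: cs) ++ D)) =
    [|| v \in flatten A1, v \in flatten (cb :: cs) | v \in flatten D].
  by rewrite (flatten_cat A1) mem_cat (flatten_cat (cb :: cs)) mem_cat.
exists top, (mid ++ b1 ++ (cb :: cs) ++ (bx :: t2) ++ M1), B1; rewrite /= eN.
split=> //; first 1 last.
- apply: (@linked_cat _ _ _ b2 _ by') => //; first by rewrite -eS.
  move: srt1; rewrite -/P eP => /cat_sorted2[_ sD].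
  exact: (path_rcons_cat pcs sD).
- by have [] := hds _ (mem_head _ _).
- split=> [v||].
  + rewrite memN => /or3P[vA|vc|vD].
    * by right; exists z2; rewrite ?mem_head //; exact: A1r.
    * have [/by_r rv|[vR _]] := hc _ vc; last by left.
      by right; exists z2; rewrite ?mem_head.
    * have := DB _ vD; rewrite in_set => /loc1[vR|[z' z'Z rz']]; first by left.
      by right; exists z' => //; rewrite inE z'Z orbT.
  + apply: (@leq_trans (#|B :&: Rall| + #|[set v in flatten (cb :: cs)]|)).
      apply: leq_trans (leq_card_setU _ _); apply/subset_leq_card/subsetP => v.
      rewrite in_setI in_set memN => /andP[/or3P[vA|vc|vD] vR].
      * by move: (region_Rall (A1r _ vA)); rewrite vR.
      * by rewrite in_setU [X in _ || X]in_set vc orbT.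
      * by rewrite in_setU in_setI (DB _ vD) vR.
    rewrite /= mulSn addnC leq_add //.
    apply: leq_trans (size_connector blc szc).
    by rewrite cardsE; exact: card_size.
  + rewrite !size_cat; move: szm sz1; clear.
    by rewrite /= !size_cat /= size_cat; nia.
- split.
    have blA : blocks A1.
      by move: bl; rewrite eS /blocks all_cat => /andP[].
    have blD : blocks D by move: bl1; rewrite -/P eP /blocks all_cat => /andP[].
    rewrite /blocks (all_cat _ A1) (all_cat _ (cb :: cs)); apply/andP; split; first exact: blA.
    by apply/andP; split; [exact: blc | exact: blD].
  rewrite (flatten_cat A1) (flatten_cat (cb :: cs)) cat_uniq cat_uniq uc.
  have : uniq (flatten (A1 ++ by' :: b2)) by rewrite -eS.
  rewrite flatten_cat cat_uniq flatten_cons => /and3P[-> nA _].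
  move: un1; rewrite -/P eP flatten_cat cat_uniq => /and3P[_ _ ->].
  rewrite /= andbT; apply/andP; split; apply/hasPn => v.
    rewrite mem_cat => /orP[vc|vD]; last first.
      by apply/negP => /A1r/zB/negP; apply; exact: DB.
    have [hv|[vR _]] := hc _ vc.
      by move/hasPn: nA; apply; rewrite mem_cat ohead_mem.
    by apply/negP => /A1r/region_Rall; rewrite vR.
  move=> vD; apply/negP => vc; have [/by_r/zB/negP|[_ /negP]] := hc _ vc;
    by apply; exact: DB.
Qed.

(** Joining the end of the chain to its own beginning closes it. A single cluster edge is no
    exception, as one of its link clusters differs from the one where the chain starts. *)
Lemma long_block_cycle z Zs : (forall z', z' \in z :: Zs -> good z') ->
  (forall s, uniq (flatten [seq slot k s z' | z' <- z :: Zs])) ->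
  (size Zs).+1 * (#|T| * k) <= h ->
  exists bs, [/\ cycle (linked E) bs, blocks bs, uniq (flatten bs) &
    (size Zs).+1 * (2 * m) <= size bs + (size Zs).+1 * (9 * h)].
Proof.
move=> gZ uZ hZ.
have [top [mid [bot [[bl un] srt htop [regb hb] [_ cR sz]]]]] := assemble gZ uZ hZ.
have [hz _ _] := head_last (gZ z (mem_head _ _)).
have [hl ll hll] := head_last (gZ _ (mem_last z Zs)).
pose B := [set v in flatten (top ++ mid ++ bot)].
have hB : #|B :&: Rall| <= h.
  by apply: leq_trans cR (leq_trans _ hZ); rewrite leq_mul2r leqW ?orbT.
have botR v : v \in flatten bot -> v \notin Rall by move/regb/region_Rall.
have [t1 [bx [t2 [b1 [by' [b2 [cb [cs [[et eb] hcb pcs [blc szc] [uc hc]]]]]]]]]] :=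
  join hz hl ll hll htop hb botR hB.
pose D := (bx :: t2) ++ mid ++ b1.
have eP : top ++ mid ++ bot = t1 ++ D ++ by' :: b2 by rewrite et eb /D !catA.
exists (D ++ cb :: cs); split.
- have : sorted (linked E) (D ++ cb :: rcons cs bx).
    apply: (@linked_cat _ _ _ b2 _ by') => //.
    by move: srt; rewrite eP => /cat_sorted2[_].
  by rewrite -rcons_cons -rcons_cat.
- rewrite /blocks (all_cat _ D); apply/andP; split; last exact: blc.
  by move: bl; rewrite eP /blocks (all_cat _ t1) (all_cat _ D) => /and3P[].
- move: un; rewrite eP (flatten_cat t1) cat_uniq => /and3P[_ _].
  rewrite (flatten_cat D) cat_uniq flatten_cons => /and3P[uD nD _].
  rewrite (flatten_cat D) cat_uniq uc uD andbT; apply/hasPn => v vc.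
  have [hv|[_ vB]] := hc _ vc.
    by move/hasPn: nD; apply; rewrite mem_cat ohead_mem.
  apply: contra vB => vD; rewrite in_set eP (flatten_cat t1) mem_cat.
  by rewrite (flatten_cat D) mem_cat [_ \in flatten D]vD orbT.
- apply: leq_trans sz _; rewrite leq_add2r /D !size_cat; clear; lia.
Qed.
End Assembly.

(** * Loose cycles and blocks *)

Lemma nth_rot (A : Type) (x0 : A) (s : seq A) i d : i < size s -> d < size s ->
  nth x0 (rot i s) d = nth x0 s ((i + d) %% size s).
Proof.
move=> iN dN; rewrite /rot nth_cat size_drop; case: ltnP => h.
  by rewrite nth_drop modn_small //; lia.
have h' : i + d = size s + (d - (size s - i)) by lia.
rewrite h' modnDl modn_small; last by lia.
by rewrite nth_take //; lia.
Qed.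

Lemma take_flatten_blocks (A : Type) n (bs : seq (seq A)) j :
  all (fun b => size b == n) bs -> take (j * n) (flatten bs) = flatten (take j bs).
Proof.
elim: bs j => [|b bs IH] [|j]; rewrite ?mul0n ?take0 ?drop0 //=.
move=> /andP[/eqP sb bl].
by rewrite mulSn -{1}sb takeD take_size_cat // drop_size_cat // IH.
Qed.

Lemma drop_flatten_blocks (A : Type) n (bs : seq (seq A)) j :
  all (fun b => size b == n) bs -> drop (j * n) (flatten bs) = flatten (drop j bs).
Proof.
elim: bs j => [|b bs IH] [|j]; rewrite ?mul0n ?take0 ?drop0 //=.
move=> /andP[/eqP sb bl].
by rewrite mulSn -{1}sb addnC -drop_drop drop_size_cat // IH.
Qed.

Lemma rot_flatten_blocks (A : Type) n (bs : seq (seq A)) j :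
  all (fun b => size b == n) bs -> rot (j * n) (flatten bs) = flatten (rot j bs).
Proof.
by move=> bl; rewrite /rot flatten_cat (drop_flatten_blocks _ bl) take_flatten_blocks.
Qed.

Lemma flatten_takes (A : Type) n q (s : seq A) :
  flatten [seq take n (drop (j * n) s) | j <- iota 0 q] = take (q * n) s.
Proof.
elim: q => [|q IH]; first by rewrite take0.
rewrite -addn1 iotaD map_cat flatten_cat IH /= cats0 add0n.
by rewrite mulnDl mul1n takeD.
Qed.

Lemma flatten_rots (A : Type) n q (s : seq A) : size s = q * n ->
  flatten [seq take n (rot (j * n) s) | j <- iota 0 q] = s.
Proof.
move=> ss; rewrite -[RHS]take_size ss -flatten_takes; congr flatten.
apply/eq_in_map => j; rewrite mem_iota add0n /= => jq.
rewrite /rot takel_cat // size_drop ss -mulnBl leq_pmull //.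
by rewrite subn_gt0.
Qed.

Lemma uniq_flatten_nth (A : eqType) (bs : seq (seq A)) i j x :
  uniq (flatten bs) -> x \in nth [::] bs i -> x \in nth [::] bs j -> i = j.
Proof.
have mem l n : x \in nth [::] l n -> x \in flatten l.
  have [nl|ln] := ltnP n (size l); last by rewrite nth_default.
  by move=> xn; apply/flattenP; exists (nth [::] l n) => //; apply: mem_nth.
elim: bs i j => [|b bs IH] i j; first by rewrite !nth_nil.
rewrite flatten_cons cat_uniq => /and3P[_ /hasPn nb ub].
case: i j => [|i] [|j] //= xi xj.
- by have := nb x (mem _ _ xj); rewrite /= xi.
- by have := nb x (mem _ _ xi); rewrite /= xj.
- by rewrite (IH i j).
Qed.

Section BlocksToCycle.
Variables (V : finType) (E : {set {set V}}) (k : nat) (bs : seq (seq V)).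
Hypotheses (k2 : 2 <= k) (cyc : cycle (linked E) bs).
Hypotheses (bl : all (fun b => size b == k.-1) bs) (un : uniq (flatten bs)).
Hypothesis M3 : 3 <= size bs.

Let M := size bs.
Let s := flatten bs.
Let blk j := nth [::] bs j.

Let M0 : 0 < M. Proof. exact: leq_trans M3. Qed.
Let M1 : 1 < M. Proof. exact: leq_trans M3. Qed.

Let modS j : j < M -> j.+1 %% M = if j.+1 == M then 0 else j.+1.
Proof.
move=> jM; case: eqP => [->|ne]; first by rewrite modnn.
by rewrite modn_small // ltn_neqAle jM andbT; apply/eqP.
Qed.

Let sizeN : size s = M * k.-1. Proof. exact: size_flatten_blocks. Qed.

Let size_blk j : j < M -> size (blk j) = k.-1.
Proof. by move=> jM; apply/eqP; apply: (all_nthP [::] bl). Qed.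

Let edge j := consecutive s k (j * k.-1).

Let edgeP j : j < M -> exists x,
  [/\ ohead (blk (j.+1 %% M)) = Some x,
      edge j = x |: [set z in blk j] & edge j \in E].
Proof.
move=> jM.
have sr : size (rot j bs) = M by rewrite size_rot.
have j1 : j.+1 %% M < M by rewrite ltn_mod.
have r0 : nth [::] (rot j bs) 0 = blk j.
  by rewrite nth_rot // addn0 modn_small.
have r1 : nth [::] (rot j bs) 1 = blk (j.+1 %% M).
  by rewrite nth_rot // addn1.
have cr : cycle (linked E) (rot j bs) by rewrite rot_cycle.
case er : (rot j bs) => [|b [|b' l]]; try by move: sr M3; rewrite er -/M /= => <-.
move: r0 r1 cr; rewrite er /= => eb eb' /andP[lk _].
have := size_blk j1; rewrite -eb'; case: b' => [|x b'] in er eb' lk *.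
  by move: k2; case: k => [|[]].
exists x; split=> //.
  rewrite /edge /consecutive rot_flatten_blocks // er /= eb.
  apply/setP => z; rewrite !inE.
  have -> : take k (blk j ++ x :: b' ++ flatten l) = rcons (blk j) x.
    rewrite -cat_rcons take_size_cat // size_rcons size_blk //.
    by move: k2; case: k.
  by rewrite mem_rcons inE.
move: lk; rewrite /= /edge /consecutive rot_flatten_blocks // er /= eb => lk.
rewrite (_ : [set _ in _] = x |: [set z in blk j]) //.
apply/setP => z; rewrite !inE.
have -> : take k (blk j ++ x :: b' ++ flatten l) = rcons (blk j) x.
  rewrite -cat_rcons take_size_cat // size_rcons size_blk //.
  by move: k2; case: k.
by rewrite mem_rcons inE.
Qed.

Let blk_inj i j x : x \in blk i -> x \in blk j -> i = j.
Proof. exact: uniq_flatten_nth. Qed.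

(** The common vertex is the head of the next block. A third block is what keeps the last vertex of
    the next edge out of the current one: two blocks would give edges sharing both heads. *)
Let edge_meet j : j < M -> #|edge j :&: edge (j.+1 %% M)| = 1.
Proof.
move=> jM; have j1 : j.+1 %% M < M by rewrite ltn_mod.
have [x [hx ex _]] := edgeP jM; have [y [hy ey _]] := edgeP j1.
apply/eqP/cards1P; exists x; apply/setP => z; rewrite ex ey !inE.
have xb := ohead_mem hx; have yb := ohead_mem hy.
case: (eqVneq z x) => [->|zx] /=; first by rewrite xb orbT.
apply/negP => /andP[zj /orP[/eqP ezy|zj1]].
  have := blk_inj zj; rewrite ezy => /(_ _ yb).
  rewrite (modS j1) (modS jM).
  by move: jM M3; rewrite -/M; clear; do 2!case: eqP; lia.
have := blk_inj zj zj1; rewrite modS //.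
by move: jM M1; clear; case: eqP; lia.
Qed.

(** If two edges coincide, a vertex of the block of one lies in the same block of the other or is
    the head of the block after it. Distinct indices would thus be cyclic successors of each other,
    impossible with three blocks. *)
Let edge_inj i j : i < M -> j < M -> edge i = edge j -> i = j.
Proof.
move=> iM jM eij.
have half l n : l < M -> n < M -> edge l = edge n -> l = n \/ l = n.+1 %% M.
  move=> lM nM eln.
  have [w hw] : exists w, w \in blk l.
    have := size_blk lM; case: (blk l) => [|w b _]; last by exists w; rewrite mem_head.
    by move: k2; case: k => [|[]].
  have [x [_ ex _]] := edgeP lM; have [y [hy ey _]] := edgeP nM.
  have : w \in edge l by rewrite ex !inE hw orbT.
  rewrite eln ey !inE => /orP[/eqP ewy|wn]; last by left; exact: blk_inj wn.
  by right; apply: (blk_inj hw); rewrite ewy (ohead_mem hy).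
have [//|] := half _ _ iM jM eij.
have [->//|] := half _ _ jM iM (esym eij); rewrite !modS //.
by move: iM jM M3; rewrite -/M; clear; do 2!case: eqP; lia.
Qed.

Lemma loose_cycle_of_blocks : exists C : hypergraph V,
  [/\ loose_cycle k C, edges C \subset E & #|verts C| = size bs * (k - 1)].
Proof.
pose I := [seq j * k.-1 | j <- iota 0 M].
pose F := [set:: [seq consecutive s k i | i <- I]].
have hk : 0 < k.-1 by move: k2; case: k => [|[]].
have FE f : f \in F -> exists2 j, j < M & f = edge j.
  rewrite inE -map_comp => /mapP[j]; rewrite mem_iota add0n => jM ->.
  by exists j.
have Fs : cover F \subset [set x in s].
  apply/bigcupsP => f /FE[j _ ->]; apply/subsetP => x; rewrite !inE.
  by move/mem_take; rewrite mem_rot.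
have cardF : #|F| = M.
  rewrite cardsE (card_uniqP _) ?size_map ?size_iota //.
  rewrite -map_comp map_inj_in_uniq ?iota_uniq // => i j.
  by rewrite !mem_iota !add0n; exact: edge_inj.
have cards : #|[set x in s]| = M * k.-1 by rewrite cardsE (card_uniqP un).
have kN : k <= size s.
  by rewrite sizeN; move: M1 k2; clear; case: k => //= n; nia.
exists (Hypergraph Fs); split; last by rewrite /= cards subn1.
- split.
  + move=> f /FE[j _ ->]; rewrite cardsE (card_uniqP _).
      by rewrite size_takel // size_rot.
    by rewrite take_uniq // rot_uniq.
  + by rewrite -card_gt0 /= cards muln_gt0 M0.
  left; exists s, I; split=> //=.
  + split.
      rewrite sorted_map; apply: sub_sorted (iota_ltn_sorted 0 M) => i j ij /=.
      by rewrite ltn_pmul2r.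
    apply/allP => _ /mapP[j + ->]; rewrite mem_iota add0n => jM.
    by rewrite sizeN ltn_pmul2r.
  + have step j : j < M -> #|edge j :&: edge (j.+1 %% M)| == 1.
      by move=> jM; rewrite edge_meet.
    rewrite /I -(prednK M0) [map _ _]/= /=.
    apply/(pathP 0) => i; rewrite size_rcons size_map size_iota ltnS => iM.
    have iM' : i < M by rewrite -(prednK M0).
    rewrite nth_rcons size_map size_iota -rcons_cons nth_rcons /= size_map size_iota.
    have -> : nth 0 (0 * k.-1 :: [seq j * k.-1 | j <- iota 1 M.-1]) i = i * k.-1.
      rewrite -[_ :: _]/[seq j * k.-1 | j <- iota 0 M.-1.+1] (nth_map 0) ?size_iota //.
      by rewrite nth_iota.
    rewrite ltnS iM; case: ltngtP iM => // [lt _|ei _].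
      rewrite (nth_map 0) ?size_iota // nth_iota //.
      have := step i iM'; rewrite modS //; case: (eqVneq i.+1 M) => [ei|//].
      by move: lt; rewrite -ltnS prednK // ei ltnn.
    by have := step i iM'; rewrite modS // ei prednK // eqxx.
  + by rewrite cardF cards subn1.
- by apply/subsetP => f /FE[j jM ->]; have [x [_ _]] := edgeP jM.
Qed.
End BlocksToCycle.

(** * Positions of the edges in a loose cycle *)

Lemma path_gaps n i0 (I : seq nat) : path (fun i j => i + n <= j) i0 I ->
  i0 + size I * n <= last i0 I.
Proof.
elim: I i0 => [|i1 I IH] i0 /=; first by rewrite addn0.
by move=> /andP[h /IH]; rewrite mulSn; lia.
Qed.

Lemma tight_gaps n i0 (I : seq nat) j : path (fun i j => i + n <= j) i0 I ->
  last i0 I <= i0 + size I * n -> j <= size I -> nth 0 (i0 :: I) j = i0 + j * n.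
Proof.
elim: I i0 j => [|i1 I IH] i0 [|j] //=; rewrite ?mul0n ?addn0 //.
move=> /andP[h p] hl jI.
have := path_gaps p; rewrite mulSn in hl => h2.
rewrite IH //; rewrite ?mulSn; move: h hl h2; clear; lia.
Qed.

Section CycleToBlocks.
Variables (T : finType) (k : nat).
Hypothesis k2 : 2 <= k.

Lemma nth_consecutive (x0 : T) (s : seq T) i d : i < size s -> d < size s -> d < k ->
  nth x0 s ((i + d) %% size s) \in consecutive s k i.
Proof.
move=> iN dN dk; rewrite inE -nth_rot // -(nth_take x0 dk).
by apply: mem_nth; rewrite size_take_min size_rot leq_min dk.
Qed.

(** The vertices at the cyclic positions [i + d] and [i + d + 1] lie in both edges. *)
Lemma card_close_consecutive (s : seq T) i d : uniq s -> k <= size s -> i < size s ->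
  d + 2 <= k ->
  1 < #|consecutive s k i :&: consecutive s k ((i + d) %% size s)|.
Proof.
move=> us kN iN dk.
have N0 : 0 < size s by exact: leq_ltn_trans iN.
have [x0 _] : exists x : T, true by case: s N0 {us kN iN} => // x; exists x.
set j := _ %% _.
have jN : j < size s by rewrite ltn_mod.
pose f e := nth x0 s ((j + e) %% size s).
have fin e : e < 2 -> f e \in consecutive s k i :&: consecutive s k j.
  move=> e2; rewrite inE; apply/andP; split; last first.
    by apply: nth_consecutive => //; move: k2 kN e2; clear; lia.
  rewrite /f modnDml -addnA; apply: nth_consecutive => //;
    move: kN dk e2; clear; lia.
apply/card_gt1P; exists (f 0), (f 1); split; [exact: fin | exact: fin |].
rewrite /f nth_uniq ?ltn_mod // addn0 modn_small //.
have [lt|ge] := ltnP (j + 1) (size s); first by rewrite modn_small //; lia.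
have -> : j + 1 = size s by move: jN ge; clear; lia.
by rewrite modnn; move: kN k2 jN ge; clear; lia.
Qed.

Lemma loose_cycle_shape (C : hypergraph T) : loose_cycle k C ->
  exists (s : seq T) (q : nat), [/\ uniq s, verts C = [set x in s], size s = q * k.-1, 0 < q &
    forall j, j < q -> consecutive s k (j * k.-1) \in edges C].
Proof.
move=> [uC vC [[s [I [[us ev] [sI aI] eE cI cE]]]|[ek cv eE]]]; last first.
  have /cards2P[u [w [uw ev]]] : #|verts C| == 2 by rewrite cv.
  exists [:: u; w], 2; rewrite ek; split=> //.
  - by rewrite /= inE uw.
  - by rewrite ev; apply/setP => x; rewrite !inE.
  - move=> j j2; rewrite eE inE ev; apply/eqP/setP => x.
    by case: j j2 => [|[|]] //= _; rewrite /consecutive !inE //= orbC.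
have sN : #|verts C| = size s by rewrite ev cardsE (card_uniqP us).
have eN : #|edges C| <= size I.
  by rewrite eE cardsE (leq_trans (card_size _)) ?size_map.
rewrite subn1 sN in cE.
have N0 : 0 < size s by rewrite -sN card_gt0.
have kN : k <= size s.
  have [e eC] : exists e, e \in edges C.
    by apply/card_gt0P; move: N0; rewrite -cE muln_gt0 => /andP[].
  have := uC e eC; move: eC; rewrite eE inE => /mapP[i _ ->] <-.
  rewrite cardsE (leq_trans (card_size _)) //.
  by rewrite size_take_min size_rot geq_minr.
case: I => [|i0 I] in sI aI eE cI eN.
  by move: N0; rewrite -cE; move: eN => /=; rewrite leqn0 => /eqP->.
have gap i j d : i < size s -> j = (i + d) %% size s ->
    #|consecutive s k i :&: consecutive s k j| == 1 -> k.-1 <= d.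
  move=> iN -> /eqP c1; rewrite leqNgt; apply/negP => lt.
  have dk : d + 2 <= k by move: lt k2; clear; lia.
  by have := card_close_consecutive us kN iN dk; rewrite c1.
have p : path (fun i j => i + k.-1 <= j) i0 I.
  move: sI cI aI; rewrite /= rcons_path => pI /andP[cI _] /andP[i0N].
  elim: I i0 i0N pI cI {eE eN} => [//|i1 I IH] i0 i0N /= /andP[i01 pI].
  move=> /andP[c01 cI] /andP[i1N aI]; rewrite IH // andbT.
  have := gap i0 i1 (i1 - i0) i0N; rewrite (subnKC (ltnW i01)) modn_small //.
  by move=> /(_ erefl c01); move: i01; clear; lia.
have lN : last i0 I < size s by move/allP: aI; apply; exact: mem_last.
have wrap : last i0 I + k.-1 <= size s + i0.
  move: cI; rewrite /= rcons_path => /andP[_ cl].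
  have i0l : i0 <= last i0 I by have := path_gaps p; move: (size I * _); clear; lia.
  have i0N : i0 < size s by exact: leq_ltn_trans lN.
  have := gap _ _ (size s + i0 - last i0 I) lN _ cl.
  rewrite subnKC; last by move: lN; clear; lia.
  by rewrite modnDl modn_small // => /(_ erefl); move: lN i0l; clear; lia.
have pos j : j < #|edges C| -> nth 0 (i0 :: I) j = i0 + j * k.-1.
  move=> jq; apply: tight_gaps => //; last by rewrite -ltnS (leq_trans jq).
  have : size s <= (size I).+1 * k.-1 by rewrite -cE leq_mul2r eN orbT.
  by rewrite mulSn; move: wrap; clear; lia.
exists (rot i0 s), #|edges C|; split=> //.
- by rewrite rot_uniq.
- by rewrite ev; apply/setP => x; rewrite !inE mem_rot.
- by rewrite size_rot.
- by move: N0; rewrite -cE muln_gt0 => /andP[].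
- move=> j jq; have jI : j < size (i0 :: I) by exact: leq_trans eN.
  have jin : nth 0 (i0 :: I) j \in i0 :: I by exact: mem_nth.
  rewrite eE inE; apply/mapP; exists (nth 0 (i0 :: I) j) => //.
  rewrite /consecutive pos // addnC rotD //.
  by rewrite addnC -pos // ltnW //; move/allP: aI; apply.
Qed.

(** Dropping the last vertex of every edge leaves the cyclic ordering [s], dropping the first leaves
    [rot 1 s]. Hence each half of each cluster is claimed exactly once. *)
Lemma loose_cycle_slots (C : hypergraph T) : loose_cycle k C ->
  exists Z : seq (seq T),
    [/\ forall z, z \in Z -> [/\ size z = k, uniq z & [set c in z] \in edges C],
        forall t, uniq (flatten [seq slot k t z | z <- Z]),
        forall t c, c \in flatten [seq slot k t z | z <- Z] -> c \in verts C &
        size Z * k.-1 = #|verts C|].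
Proof.
move=> lC; have [uC _ _] := lC.
have [s [q [us ev sN q0 hE]]] := loose_cycle_shape lC.
have kN : k <= size s.
  rewrite -(uC _ (hE 0 q0)) cardsE (leq_trans (card_size _)) //.
  by rewrite size_take_min size_rot geq_minr.
pose Z := [seq take k (rot (j * k.-1) s) | j <- iota 0 q].
have sl t : flatten [seq slot k t z | z <- Z] = if t then rot 1 s else s.
  rewrite -map_comp; case: t; last first.
    rewrite -[RHS](flatten_rots sN); congr flatten; apply: eq_map => j /=.
    by rewrite take_takel // leq_pred.
  rewrite -[RHS](@flatten_rots _ k.-1 q) ?size_rot //.
  congr flatten; apply: eq_map => j /=; rewrite rot_rot.
  have : size (rot (j * k.-1) s) = size s by rewrite size_rot.
  case: (rot _ s) => [|x l] /= sl.
    by move: kN k2; rewrite -sl; clear; lia.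
  rewrite /= rot1_cons; move: kN k2; rewrite -sl; case: k => //= n nl _.
  by rewrite -cats1 takel_cat.
exists Z; split.
- move=> z /mapP[j]; rewrite mem_iota add0n => jq ->; split.
  + by rewrite size_takel ?size_rot.
  + by rewrite take_uniq ?rot_uniq.
  + exact: hE.
- by move=> t; rewrite sl; case: t; rewrite ?rot_uniq.
- by move=> t c; rewrite sl ev inE; case: t; rewrite ?mem_rot.
- by rewrite size_map size_iota ev cardsE (card_uniqP us) sN.
Qed.
End CycleToBlocks.

(** * Hole regularity *)

Section Crossings.
Variables (T V : finType) (e : {set T}) (A : T -> {set V}).
Hypothesis dA : {in e &, forall a b, a != b -> [disjoint A a & A b]}.

Let dA_eq a b x : a \in e -> b \in e -> x \in A a -> x \in A b -> a = b.
Proof.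
move=> ae be xa xb; apply/eqP/negPn/negP => ab.
by have /pred0P/(_ x)/= := dA ae be ab; rewrite xa xb.
Qed.

Lemma crossing_point (S : {set V}) b : crossing e A S -> b \in e ->
  exists2 x, x \in S & x \in A b.
Proof.
move=> /andP[_ /forall_inP h] be; have /cards1P[x ex] := h b be.
by exists x; have := set11 x; rewrite -ex inE => /andP[].
Qed.

Lemma crossing_inj (S : {set V}) b x y : crossing e A S -> b \in e ->
  x \in S -> y \in S -> x \in A b -> y \in A b -> x = y.
Proof.
move=> /andP[_ /forall_inP h] be xS yS xb yb.
have /cards1P[z ez] := h b be.
have : x \in S :&: A b by rewrite inE xS.
have : y \in S :&: A b by rewrite inE yS.
by rewrite ez !inE => /eqP-> /eqP->.
Qed.

Lemma card_crossing (S : {set V}) : crossing e A S -> #|S| = #|e|.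
Proof.
move=> tr; have /andP[/subsetP Ssub /forall_inP h] := tr.
pose F b := if b \in e then S :&: A b else set0.
have dF a b : a != b -> [disjoint F a & F b].
  move=> ab; rewrite /F; case: ifP => ae; last by rewrite disjoints_subset sub0set.
  case: ifP => be; last by rewrite disjoint_sym disjoints_subset sub0set.
  by apply: disjointWl (subsetIr _ _) _; apply: disjointWr (subsetIr _ _) (dA _ _ _).
have eS : S = \bigcup_b F b.
  apply/setP => x; apply/idP/bigcupP => [xS|[b _]].
    by have /bigcupP[b be xb] := Ssub x xS; exists b; rewrite // /F be inE xS.
  by rewrite /F; case: ifP; rewrite !inE // => _ /andP[].
rewrite -sum1_card [in LHS]eS partition_disjoint_bigcup //.
rewrite -sum1_card (bigID [in e]) /= [X in _ + X]big1 ?addn0.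
  by apply: eq_bigr => b be; rewrite sum1_card /F be; apply/eqP/h.
by move=> b /negPf be; rewrite /F be big_set0.
Qed.

Lemma card_crossings h : {in e, forall b, h <= #|A b|} ->
  h ^ #|e| <= #|[set S : {set V} | crossing e A S]|.
Proof.
move=> hA; have [e0|[b0 b0e]] := set_0Vmem e.
  rewrite e0 cards0 expn0 card_gt0; apply/set0Pn; exists set0.
  rewrite inE /crossing sub0set; apply/forall_inP => b.
  by rewrite inE.
have [->|h0] := posnP h; first by rewrite exp0n // card_gt0; apply/set0Pn; exists b0.
have [y0 _] : exists y0, y0 \in A b0 by apply/card_gt0P; apply: leq_trans (hA _ b0e).
(* Choice functions, with [y0] as the default value outside [e]; their images are the crossing
   sets. *)
pose Q := pfamily y0 (mem e) (fun b => mem (A b)).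
have cQ : h ^ #|e| <= #|Q|.
  rewrite card_pfamily foldrE big_map big_enum /= -prod_nat_const.
  by apply: leq_prod => b be; exact: hA.
apply: leq_trans cQ _.
have fe f b : f \in Q -> b \in e -> f b \in A b.
  by move=> /pfamilyP[_ hf] be; exact: hf.
have mf f b : f \in Q -> b \in e -> (f @: e) :&: A b = [set f b].
  move=> fQ be; apply/setP => x; rewrite !inE; apply/andP/eqP => [[]|->].
    by move=> /imsetP[a ae ->] fab; rewrite (dA_eq ae be (fe _ _ fQ ae) fab).
  by split; [exact: imset_f | exact: fe].
rewrite -(@card_in_imset _ _ (fun f : {ffun T -> V} => f @: e) Q).
  apply/subset_leq_card/subsetP => _ /imsetP[f fQ ->]; rewrite inE.
  apply/andP; split.
    by apply/subsetP => _ /imsetP[b be ->]; apply/bigcupP; exists b; rewrite ?fe.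
  by apply/forall_inP => b be; rewrite mf // cards1.
move=> f g fQ gQ efg; apply/ffunP => b; case: (boolP (b \in e)) => be.
  by apply/eqP; rewrite -in_set1 -(mf g) // -efg mf // set11.
have /pfamilyP[/supportP fs _] := fQ; have /pfamilyP[/supportP gs _] := gQ.
by rewrite fs ?gs.
Qed.
End Crossings.

(** Blocks are cut off greedily: as long as more than [m] vertices per label remain uncovered, some
    label has [m] of them. *)
Lemma chop (V L : finType) (f : V -> L) (m : nat) : 0 < m ->
  exists P : {set {set V}}, [/\ trivIset P, {in P, forall b : {set V}, #|b| = m},
    {in P, forall b : {set V}, {in b &, forall x y, f x = f y}},
    #|cover P| = #|P| * m & #|V| <= #|P| * m + #|f @: [set: V]| * m].
Proof.
move=> m0.
have cov (P : {set {set V}}) : trivIset P -> {in P, forall b : {set V}, #|b| = m} ->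
    #|cover P| = #|P| * m.
  by move=> /eqP <- Pm; rewrite -sum_nat_const; apply: eq_bigr.
have step N : exists P : {set {set V}}, [/\ trivIset P,
    {in P, forall b : {set V}, #|b| = m},
    {in P, forall b : {set V}, {in b &, forall x y, f x = f y}} &
    N <= #|P| \/ #|V| <= #|P| * m + #|f @: [set: V]| * m].
  elim: N => [|N [P [tP Pm Pf [NP|big]]]]; last by exists P; split=> //; right.
    exists set0; split; [|by move=> b; rewrite inE|by move=> b; rewrite inE|by left].
    by apply/trivIsetP => B; rewrite inE.
  have [le|gt] := leqP #|V| (#|P| * m + #|f @: [set: V]| * m).
    by exists P; split=> //; right.
  pose X l := ~: cover P :&: [set x | f x == l].
  have [l hl] : exists l, m <= #|X l|.
    case: (boolP [exists l, m <= #|X l|]) => [/existsP //|].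
    rewrite negb_exists => /forallP no; exfalso.
    have : #|~: cover P| <= #|f @: [set: V]| * m.
      rewrite -sum1_card (partition_big_imset f) /=.
      apply: (@leq_trans (\sum_(l in f @: ~: cover P) m)).
        apply: leq_sum => l _; rewrite sum1dep_card.
        have := no l; rewrite -ltnNge => /ltnW; apply: leq_trans.
        by apply/subset_leq_card/subsetP => x; rewrite !inE.
      by rewrite sum_nat_const leq_mul2r subset_leq_card ?orbT // imsetS ?subsetT.
    by have := cardsC (cover P); rewrite (cov P tP Pm); move: gt; clear; lia.
  have /card_geqP[s [us sm sX]] := hl.
  pose b := [set x in s].
  have bm : #|b| = m by rewrite cardsE (card_uniqP us).
  have bX x : x \in b -> x \notin cover P /\ f x = l.
    by rewrite inE => /sX; rewrite !inE => /andP[-> /eqP].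
  have db : {in P, forall B : {set V}, [disjoint b & B]}.
    move=> B BP; apply/pred0P => x /=; apply/negP => /andP[/bX[/negP xP _] xB].
    by apply: xP; apply/bigcupP; exists B.
  have [|tP' nbP] := trivIsetU1 db tP.
    by apply/negP => /Pm; rewrite cards0 => m00; move: m0; rewrite -m00.
  exists (b |: P); split=> //.
  - by move=> B; rewrite !inE => /orP[/eqP->|/Pm].
  - move=> B; rewrite !inE => /orP[/eqP-> x y /bX[_ ->] /bX[_ ->] //|/Pf].
    exact.
  - by left; rewrite cardsU1 nbP.
have [P [tP Pm Pf [lt|le]]] := step #|V|.+1.
  have : #|cover P| <= #|V| by exact: max_card.
  rewrite (cov P tP Pm) leqNgt => /negP[]; apply: leq_trans lt _.
  exact: leq_pmulr.
by exists P; split=> //; exact: cov.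
Qed.

(** A crossing set determines its tuple of clusters, so pairs coming from different tuples never
    coincide. *)
Lemma pblock_imset_crossing (V : finType) (P e : {set {set V}})
    (A : {set V} -> {set V}) S : trivIset P -> e \subset P ->
  {in e, forall b, A b \subset b} -> crossing e A S -> e = pblock P @: S.
Proof.
move=> tP /subsetP eP Ab cr; apply/setP => b; apply/idP/imsetP => [be|[x xS ->]].
  have [x xS xb] := crossing_point cr be; exists x => //.
  by rewrite (def_pblock tP (eP _ be)) // (subsetP (Ab _ be)).
have /andP[/subsetP sub _] := cr; have /bigcupP[b' be xb] := sub x xS.
by rewrite (def_pblock tP (eP _ be)) // (subsetP (Ab _ be)).
Qed.

(** If [P] respects the sets [A], the clusters of [P] met by a crossing set form a tuple inside the
    same box. A colour missing from the box is then missing from that finer tuple. *)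
Lemma refine_crossing (T V : finType) (e : {set T}) (A : T -> {set V})
    (P : {set {set V}}) (S : {set V}) :
  {in e &, forall a b, a != b -> [disjoint A a & A b]} -> trivIset P ->
  {in P, forall b' : {set V}, {in b' &, forall x y,
     {in e, forall b, (x \in A b) -> (y \in A b)}}} ->
  crossing e A S -> S \subset cover P ->
  [/\ pblock P @: S \subset P, #|pblock P @: S| = #|e|,
      crossing (pblock P @: S) id S &
      forall S', crossing (pblock P @: S) id S' -> crossing e A S'].
Proof.
move=> dA tP resp cr /subsetP SP; have /andP[/subsetP sub _] := cr.
have pP x : x \in S -> pblock P x \in P by move/SP/pblock_mem.
have px x : x \in S -> x \in pblock P x by move/SP; rewrite mem_pblock.
have same x y b : x \in S -> b \in e -> x \in A b -> y \in pblock P x -> y \in A b.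
  by move=> xS be xb yx; apply: (resp _ (pP x xS) x y _ _ b be xb); first exact: px.
have binj : {in S &, injective (pblock P)}.
  move=> x y xS yS exy; have /bigcupP[b be xb] := sub x xS.
  by apply: (crossing_inj cr be) => //; apply: (same x) => //; rewrite exy px.
have trid x y : x \in S -> y \in S -> x \in pblock P y -> x = y.
  by move=> xS yS /(same_pblock tP)/binj; exact.
split.
- by apply/subsetP => _ /imsetP[x xS ->]; exact: pP.
- by rewrite card_in_imset // (card_crossing dA cr).
- apply/andP; split.
    by apply/subsetP => x xS; apply/bigcupP; exists (pblock P x); rewrite ?px ?imset_f.
  apply/forall_inP => _ /imsetP[x xS ->]; apply/cards1P; exists x.
  apply/setP => y; rewrite !inE; apply/andP/eqP => [[yS yx]|->]; last by rewrite px.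
  exact: trid.
- move=> S' cr'; have /andP[/subsetP sub' _] := cr'; apply/andP; split.
    apply/subsetP => y /sub' /bigcupP[_ /imsetP[x xS ->] yx].
    have /bigcupP[b be xb] := sub x xS.
    by apply/bigcupP; exists b => //; exact: (same x).
  apply/forall_inP => b be; have [x xS xb] := crossing_point cr be.
  have xe : pblock P x \in pblock P @: S by exact: imset_f.
  have [y yS' yx] := crossing_point cr' xe.
  apply/cards1P; exists y; apply/setP => z; rewrite !inE.
  apply/andP/eqP => [[zS' zb]|->]; last by split=> //; exact: (same x).
  have /bigcupP[_ /imsetP[w wS ->] zw] := sub' z zS'.
  have /bigcupP[b2 b2e wb2] := sub w wS.
  have zb2 : z \in A b2 by exact: (same w).
  have ebb : b2 = b.
    apply/eqP/negPn/negP => ne.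
    by have /pred0P/(_ z)/= := dA _ _ b2e be ne; rewrite zb zb2.
  have ewx : w = x by apply: (crossing_inj cr be) => //; rewrite -ebb.
  by apply: (crossing_inj cr' xe) => //; rewrite -ewx.
Qed.

Lemma card_meeting (V : finType) (k : nat) (X : {set V}) :
  #|[set S : {set V} | (#|S| == k) && ~~ [disjoint S & X]]| <=
  #|X| * #|V| ^ k.-1.
Proof.
pose F (p : V * k.-1.-tuple V) := p.1 |: [set x in p.2].
rewrite -card_tuple -cardsT -cardsX.
apply: leq_trans (leq_imset_card F _); apply/subset_leq_card/subsetP => S.
rewrite inE => /andP[/eqP Sk /pred0Pn[x /= /andP[xS xX]]].
have sz : size (enum (S :\ x)) == k.-1.
  by rewrite -cardE; have := cardsD1 x S; rewrite xS Sk => ->.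
apply/imsetP; exists (x, Tuple sz); first by rewrite !inE xX.
apply/setP => y; rewrite !inE /= mem_enum !inE.
by case: eqVneq => [->|_].
Qed.

Lemma ffact_le_expn n m : n ^_ m <= n ^ m.
Proof.
elim: m n => [//|m IH] n; rewrite ffactnS expnS leq_mul2l; apply/orP; right.
apply: leq_trans (IH _) _; case: m {IH} => [//|m].
by rewrite leq_exp2r // leq_pred.
Qed.

(** * The potential and one refinement step *)

Section Regularity.
Variables (V : finType) (E : {set {set V}}) (k r : nat) (c : {set V} -> 'I_r).

Definition color_class i := [set S in E | c S == i].

Definition kfamilies (P : {set {set V}}) : {set {set {set V}}} :=
  [set e : {set {set V}} | (e \subset P) && (#|e| == k)].

(* The potential: the pairs (S, i) such that S crosses a [k]-tuple of clusters
   without crossing edge of colour [i]. *)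
Definition empties (P : {set {set V}}) : {set {set V} * 'I_r} :=
  [set p : {set V} * 'I_r | [exists e in kfamilies P,
     crossing e id p.1 && [forall S in color_class p.2, ~~ crossing e id S]]].

Definition irregular (h : nat) (P : {set {set V}}) : {set {set {set V}}} :=
  [set e in kfamilies P | `[< forall i, ~ hole_free (color_class i) h e id >]].

Lemma disjoint_kfamily (P e : {set {set V}}) (A : {set V} -> {set V}) :
  trivIset P -> e \subset P -> {in e, forall b : {set V}, A b \subset b} ->
  {in e &, forall a b : {set V}, a != b -> [disjoint A a & A b]}.
Proof.
move=> /trivIsetP tP /subsetP eP Ab a b ae be ab.
apply: disjointWl (Ab a ae) _; apply: disjointWr (Ab b be) _.
by apply: tP => //; exact: eP.
Qed.

Lemma card_empties P : trivIset P -> #|empties P| <= r * #|V| ^ k.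
Proof.
move=> tP; apply: (@leq_trans #|setX [set S : {set V} | #|S| == k] [set: 'I_r]|).
  apply/subset_leq_card/subsetP => p; rewrite inE => /exists_inP[e].
  rewrite inE => /andP[eP /eqP ek] /andP[cr _]; rewrite !inE andbT.
  by rewrite (card_crossing _ cr) ?ek //; exact: (disjoint_kfamily tP).
rewrite cardsX cardsT card_ord card_draws mulnC leq_mul2l.
apply/orP; right; apply: leq_trans (leq_pmulr _ (fact_gt0 k)) _.
by rewrite bin_ffact; exact: ffact_le_expn.
Qed.

(** The label of a vertex is its cluster, or the empty set if uncovered (at most t + 1 values),
    together with the set of pairs (tuple, colour) whose hole contains the vertex (at most 2^t r
    pairs). *)
Definition nlabels t := t.+1 * 2 ^ (2 ^ t * r).

Lemma nlabels_mono t t' : t <= t' -> nlabels t <= nlabels t'.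
Proof.
by move=> tt; rewrite leq_mul ?leq_pexp2l ?leq_mul2r ?leq_pexp2l ?tt ?orbT.
Qed.

(** Old empty pairs survive the refinement, and each irregular tuple contributes [h ^ k] new ones.
    The error term bounds the pairs whose set meets the vertices left over by [chop]. *)
Lemma refine_step P m' h t : trivIset P -> #|P| <= t -> 0 < m' ->
  {in kfamilies P, forall e : {set {set V}}, exists2 S, S \in E & crossing e id S} ->
  exists P' : {set {set V}}, [/\ trivIset P',
    {in P', forall b : {set V}, #|b| = m'},
    #|V| <= #|P'| * m' + nlabels t * m' &
    #|empties P| + #|irregular h P| * h ^ k <=
    #|empties P'| + r * (nlabels t * m' * #|V| ^ k.-1)].
Proof.
move=> tP Pt m0 full.
pose hole (ei : {set {set V}} * 'I_r) (A : {set V} -> {set V}) :=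
  ~ hole_free (color_class ei.2) h ei.1 id ->
  [/\ {in ei.1, forall b : {set V}, A b \subset b},
      {in ei.1, forall b : {set V}, h <= #|A b|} &
      {in color_class ei.2, forall S : {set V}, ~~ crossing ei.1 A S}].
have /choice[A hA] : forall ei, exists A, hole ei A.
  move=> ei; have [hf|nhf] := pselect (hole_free (color_class ei.2) h ei.1 id).
    by exists id.
  have [[A [Ab hA no]]|none] := pselect (exists A : {set V} -> {set V},
     [/\ {in ei.1, forall b : {set V}, A b \subset b},
      {in ei.1, forall b : {set V}, h <= #|A b|} &
      {in color_class ei.2, forall S : {set V}, ~~ crossing ei.1 A S}]).
    by exists A.
  exfalso; apply: nhf => A Ab cA.
  have [S /andP[SE cr]|no] := pickP (fun S => (S \in color_class ei.2) && crossing ei.1 A S).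
    by exists S.
  case: none; exists A; split=> // S SE; have := no S.
  by rewrite SE /= => ->.
(* The colour [io e] occurs in the tuple [e], so no set crossing [e] is yet counted with it. *)
have /choice[io hio] : forall e, exists i, e \in kfamilies P ->
    exists2 S, S \in color_class i & crossing e id S.
  move=> e; have [eP|neP] := boolP (e \in kfamilies P); last first.
    by exists (c set0).
  have [S SE cr] := full e eP; exists (c S) => _.
  by exists S => //; rewrite inE SE eqxx.
(* Refine every cluster by all the holes meeting it, then cut into equal pieces. *)
pose lab v := [set ei in setX (powerset P) [set: 'I_r] | v \in A ei (pblock P v)].
pose f v := (pblock P v, lab v).
have [P' [tP' Pm' Pf cov le]] := chop f m0.
have nlab : #|f @: [set: V]| <= nlabels t.
  apply: (@leq_trans #|setX (set0 |: P) (powerset (setX (powerset P) [set: 'I_r]))|).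
    apply/subset_leq_card/subsetP => _ /imsetP[v _ ->]; rewrite inE /= inE.
    apply/andP; split; last by rewrite inE; apply/subsetP => x; rewrite inE => /andP[].
    have [vP|vP] := boolP (v \in cover P); first by rewrite pblock_mem ?orbT // inE.
    rewrite inE; apply/orP; left; apply/eqP/setP => x; rewrite inE.
    apply/negP; rewrite /pblock; case: pickP => [B /andP[BP vB]|_]; last by rewrite inE.
    by case/negP: vP; apply/bigcupP; exists B.
  rewrite cardsX card_powerset cardsX card_powerset cardsT card_ord.
  apply: leq_trans (nlabels_mono Pt); rewrite /nlabels leq_mul2r.
  by apply/orP; right; rewrite cardsU1; exact: (leq_add (leq_b1 _) (leqnn #|P|)).
exists P'; split=> //.
  by apply: leq_trans le _; rewrite leq_add2l leq_mul2r nlab orbT.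
pose X := ~: cover P'.
have cX : #|X| <= nlabels t * m'.
  have := cardsC (cover P'); rewrite -/X cov => e1.
  have : #|X| <= #|f @: [set: V]| * m' by move: le e1; clear; lia.
  by move/leq_trans; apply; rewrite leq_mul2r nlab orbT.
have same b' x y b : b' \in P' -> x \in b' -> y \in b' -> b \in P -> x \in b ->
    y \in b /\ lab x = lab y.
  move=> b'P xb' yb' bP xb; have := Pf _ b'P x y xb' yb'; rewrite /f => -[epb ->].
  split=> //; have eb := def_pblock tP bP xb.
  have : x \in pblock P y by rewrite -epb eb.
  rewrite -eb epb /pblock; case: pickP => [B /andP[_ yB] _|_]; first by [].
  by rewrite inE.
have respid (e : {set {set V}}) : e \subset P -> {in P', forall b' : {set V}, {in b' &, forall x y,
     {in e, forall b : {set V}, (x \in b) -> (y \in b)}}}.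
  move=> eP b' b'P x y xb yb b be xb1; have bP := subsetP eP b be.
  by have [] := same b' x y b b'P xb yb bP xb1.
have irrP e : e \in irregular h P ->
    [/\ e \subset P, #|e| = k, e \in kfamilies P & hole (e, io e) (A (e, io e))].
  rewrite inE => /andP[ek _]; split=> //; by move: ek; rewrite inE => /andP[? /eqP].
have irrA e : e \in irregular h P ->
   [/\ {in e, forall b : {set V}, A (e, io e) b \subset b},
      {in e, forall b : {set V}, h <= #|A (e, io e) b|} &
      {in color_class (io e), forall S : {set V}, ~~ crossing e (A (e, io e)) S}].
  move=> eI; have [_ _ _ H] := irrP e eI; apply: H.
  by move: eI; rewrite inE => /andP[_ /asboolP]; apply.
have respA e : e \in irregular h P ->
   {in P', forall b' : {set V}, {in b' &, forall x y,
     {in e, forall b : {set V}, x \in A (e, io e) b -> y \in A (e, io e) b}}}.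
  move=> eI b' b'P x y xb yb b be xA.
  have [eP _ _ _] := irrP e eI; have [Ab _ _] := irrA e eI.
  have xb1 : x \in b by rewrite (subsetP (Ab b be)).
  have bP := subsetP eP b be.
  have [yb1 elab] := same b' x y b b'P xb yb bP xb1.
  have : (e, io e) \in lab x.
    by rewrite inE in_setX powersetE in_setT (def_pblock tP bP xb1) xA eP.
  by rewrite elab !inE (def_pblock tP bP yb1) => /andP[].
(* The sets crossing the hole of an irregular tuple [e] in colour [io e]: these become the new
   pairs. *)
pose Q := [set p : {set {set V}} * {set V} |
  (p.1 \in irregular h P) && crossing p.1 (A (p.1, io p.1)) p.2].
have cQ : #|irregular h P| * h ^ k <= #|Q|.
  rewrite -[leqRHS]sum1_card (eq_bigl (fun p => (p.1 \in irregular h P) &&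
    crossing p.1 (A (p.1, io p.1)) p.2)); last by move=> p; rewrite inE.
  rewrite -(pair_big_dep (fun e => e \in irregular h P)
    (fun e S => crossing e (A (e, io e)) S) (fun _ _ => 1)) /=.
  rewrite -sum_nat_const; apply: leq_sum => e eI.
  have [eP ek _ _] := irrP e eI; have [Ab hAb _] := irrA e eI.
  rewrite sum1dep_card -ek; apply: card_crossings => //.
  exact: (disjoint_kfamily tP).
pose g (p : {set {set V}} * {set V}) := (p.2, io p.1).
have Qpb p : p \in Q -> p.1 = pblock P @: p.2.
  rewrite inE => /andP[eI cr]; have [eP _ _ _] := irrP _ eI.
  by have [Ab _ _] := irrA _ eI; exact: pblock_imset_crossing cr.
have ginj : {in Q &, injective g}.
  move=> p q pQ qQ [eS _]; have := Qpb p pQ; rewrite eS -(Qpb q qQ).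
  by case: p q eS {pQ qQ} => [? ?] [? ?] /= -> ->.
have dQ : [disjoint empties P & g @: Q].
  apply/pred0P => p /=; apply/negP => /andP[pe /imsetP[q qQ epq]].
  have eq1 := Qpb q qQ; move: qQ; rewrite inE => /andP[eI _].
  have [eP ek efam _] := irrP _ eI.
  move: pe; rewrite inE epq /= => /exists_inP[e]; rewrite inE => /andP[eP2 _].
  move=> /andP[cr /forall_inP no].
  have ee : e = q.1.
    by rewrite eq1; apply: (pblock_imset_crossing tP eP2 _ cr) => b _.
  have [S SE crS] := hio _ efam.
  by have := no S SE; rewrite ee crS.
(* The pairs that may be lost: their set meets the leftover vertices. *)
pose touch := setX [set S : {set V} | (#|S| == k) && ~~ [disjoint S & X]] [set: 'I_r].
have ct : #|touch| <= r * (nlabels t * m' * #|V| ^ k.-1).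
  rewrite cardsX cardsT card_ord mulnC leq_mul2l; apply/orP; right.
  by apply: leq_trans (card_meeting _ _) _; rewrite leq_mul2r cX orbT.
have sub : (empties P :|: g @: Q) \subset empties P' :|: touch.
  apply/subsetP => p; rewrite in_setU => hp; rewrite in_setU.
  have [SX|SX] := boolP [disjoint p.1 & X]; last first.
    apply/orP; right; rewrite !inE SX !andbT /=.
    case/orP: hp => [|/imsetP[q]].
      rewrite inE => /exists_inP[e]; rewrite inE => /andP[eP ek] /andP[cr _].
      have de := disjoint_kfamily tP eP (fun b _ => subxx b).
      by rewrite (card_crossing de cr).
    rewrite inE => /andP[eI cr] ->; have [eP ek _ _] := irrP _ eI.
    have [Ab _ _] := irrA _ eI; have de := disjoint_kfamily tP eP Ab.
    by rewrite /= (card_crossing de cr) ek.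
  have Sc : p.1 \subset cover P' by move: SX; rewrite disjoints_subset setCK.
  apply/orP; left; rewrite inE; apply/exists_inP; exists (pblock P' @: p.1).
    case/orP: hp => [|/imsetP[q]].
      rewrite inE => /exists_inP[e]; rewrite inE => /andP[eP /eqP ek] /andP[cr _].
      have de := disjoint_kfamily tP eP (fun b _ => subxx b).
      have [eP' ek' _ _] := refine_crossing de tP' (respid e eP) cr Sc.
      by rewrite inE eP' ek' ek eqxx.
    rewrite inE => /andP[eI cr] ep; have [eP ek _ _] := irrP _ eI.
    have [Ab _ _] := irrA _ eI; have de := disjoint_kfamily tP eP Ab.
    move: Sc; rewrite ep => Sc.
    have [eP' ek' _ _] := refine_crossing de tP' (respA _ eI) cr Sc.
    by rewrite inE eP' ek' ek eqxx.
  case/orP: hp => [|/imsetP[q]].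
    rewrite inE => /exists_inP[e]; rewrite inE => /andP[eP _] /andP[cr /forall_inP no].
    have de := disjoint_kfamily tP eP (fun b _ => subxx b).
    have [_ _ -> tr] := refine_crossing de tP' (respid e eP) cr Sc.
    by apply/forall_inP => S /no; apply: contra; exact: tr.
  rewrite inE => /andP[eI cr] ep; have [eP _ _ _] := irrP _ eI.
  have [Ab _ no] := irrA _ eI; have de := disjoint_kfamily tP eP Ab.
  move: Sc; rewrite ep => Sc.
  have [_ _ -> tr] := refine_crossing de tP' (respA _ eI) cr Sc.
  by apply/forall_inP => S /no; apply: contra; exact: tr.
apply: leq_trans (leq_add (leqnn _) ct).
apply: leq_trans (_ : #|empties P :|: g @: Q| <= _).
  by rewrite cardsU (disjoint_setI0 dQ) cards0 subn0 card_in_imset // leq_add2l.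
apply: leq_trans (subset_leq_card sub) _.
by rewrite cardsU leq_subr.
Qed.
End Regularity.

(** * Iterating the refinement *)

Definition box_full (V : finType) (E : {set {set V}}) (k h : nat) : Prop :=
  forall e : {set {set V}}, trivIset e -> #|e| = k ->
    {in e, forall b : {set V}, h <= #|b|} -> exists2 S, S \in E & crossing e id S.

(** After j refinements the clusters have size n / [scale M r j], so there are at most twice
    [scale M r j] of them. The factor [M] in the recursion makes the leftover, at most one cluster
    size per label, at most n / M. *)
Fixpoint scale (M r j : nat) : nat :=
  if j is i.+1 then M * nlabels r (2 * scale M r i) else M.

Lemma nlabels_gt r t : t < nlabels r t.
Proof. by rewrite /nlabels leq_pmulr // expn_gt0. Qed.

Lemma scale_gt0 M r j : 0 < M -> 0 < scale M r j.
Proof.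
by case: j => [//|j] M0; rewrite /= muln_gt0 M0 (leq_ltn_trans _ (nlabels_gt _ _)).
Qed.

Lemma scale_mono M r i j : 0 < M -> i <= j -> scale M r i <= scale M r j.
Proof.
move=> M0; elim: j => [|j IH]; first by rewrite leqn0 => /eqP->.
rewrite leq_eqVlt ltnS => /orP[/eqP->//|/IH le]; apply: leq_trans le _.
apply: leq_trans (_ : 2 * scale M r j <= _); first exact: leq_pmull.
by apply: leq_trans (leq_pmull _ M0); exact: ltnW (nlabels_gt _ _).
Qed.

(** Were every partition irregular, [D] times the potential would gain at least 2 n^k per step and
    lose at most n^k because [D * r <= M]. After [D * r + 1] steps it would exceed its maximum
    [D * r] n^k. *)
Theorem regular_partition (k r q D M : nat) : 0 < k -> 0 < D -> D * r <= M -> 2 <= M ->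
  exists2 W, 0 < W & forall (V : finType) (E : {set {set V}}) (c : {set V} -> 'I_r),
    W <= #|V| -> box_full E k (#|V| %/ W) ->
    exists (P : {set {set V}}) (m : nat),
      [/\ trivIset P /\ {in P, forall b : {set V}, #|b| = m},
          #|V| %/ W <= m /\ m * M <= #|V|, #|P| <= 2 * W,
          M * #|V| <= M * (#|P| * m) + #|V| &
          D * (#|irregular E k c (m %/ q) P| * (m %/ q) ^ k) < 2 * #|V| ^ k].
Proof.
move=> k0 D0 DM M2; have M0 : 0 < M by exact: leq_trans M2.
pose J := (D * r).+1; exists (scale M r J); first exact: scale_gt0.
move=> V E c Wn full; set n := #|V| in Wn full *.
have Wn' j : j <= J -> scale M r j <= n.
  by move=> jJ; apply: leq_trans Wn; exact: scale_mono.
have n0 : 0 < n by apply: leq_trans Wn; exact: scale_gt0.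
pose m j := n %/ scale M r j.
have m0 j : j <= J -> 0 < m j by move=> jJ; rewrite divn_gt0 ?scale_gt0 // Wn'.
have mJ j : j <= J -> n %/ scale M r J <= m j.
  by move=> jJ; apply: leq_div2l; [exact: scale_gt0 | exact: scale_mono].
have mM j : j <= J -> m j * M <= n.
  move=> jJ; apply: leq_trans (leq_trunc_div n (scale M r j)).
  rewrite leq_mul2l; apply/orP; right.
  by rewrite -[leqLHS]/(scale M r 0) scale_mono.
have tW j (P : {set {set V}}) : j <= J -> trivIset P ->
    {in P, forall b : {set V}, #|b| = m j} -> #|P| <= 2 * scale M r j.
  move=> jJ /eqP tP Pm; have : #|P| * m j <= n.
    by rewrite -sum_nat_const -(eq_bigr _ Pm) tP max_card.
  have := ltn_ceil n (scale_gt0 r j M0); have := m0 j jJ; rewrite -/(m j).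
  move: (scale M r j) (m j) => w mj; clear; nia.
have [//|none] := pselect (exists (P : {set {set V}}) (m : nat),
      [/\ trivIset P /\ {in P, forall b : {set V}, #|b| = m},
          n %/ scale M r J <= m /\ m * M <= n, #|P| <= 2 * scale M r J,
          M * n <= M * (#|P| * m) + n &
          D * (#|irregular E k c (m %/ q) P| * (m %/ q) ^ k) < 2 * n ^ k]).
have step j : j <= J -> exists P : {set {set V}},
    [/\ trivIset P, {in P, forall b : {set V}, #|b| = m j},
        M * n <= M * (#|P| * m j) + n & j * n ^ k <= D * #|empties E k c P|].
  elim: j => [|j IH] jJ.
    have [P [tP Pm _ _ le]] := chop (fun _ : V => tt) (m0 0 jJ).
    exists P; split=> //; rewrite ?mul0n //.
    have l1 : #|(fun _ : V => tt) @: [set: V]| <= 1.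
      by apply: leq_trans (max_card _) _; rewrite card_unit.
    rewrite -/n in le; have mM0 := mM 0 jJ.
    have : n <= #|P| * m 0 + 1 * m 0.
      by apply: leq_trans le _; rewrite leq_add2l leq_mul2r l1 orbT.
    rewrite mul1n -(leq_pmul2l M0) mulnDr => /leq_trans; apply.
    by rewrite leq_add2l mulnC.
  have jJ' := ltnW jJ; have [P [tP Pm cov pot]] := IH jJ'.
  have irr : 2 * n ^ k <= D * (#|irregular E k c (m j %/ q) P| * (m j %/ q) ^ k).
    rewrite leqNgt; apply/negP => lt; apply: none; exists P, (m j).
    split=> //; [by split; [exact: mJ | exact: mM]|].
    apply: leq_trans (tW j P jJ' tP Pm) _.
    by rewrite leq_mul2l scale_mono ?orbT.
  have fullP : {in kfamilies k P, forall e : {set {set V}},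
      exists2 S, S \in E & crossing e id S}.
    move=> e; rewrite inE => /andP[eP /eqP ek]; apply: full => //.
      exact: trivIsetS tP.
    by move=> b be; rewrite (Pm b (subsetP eP b be)) mJ.
  have [P' [tP' Pm' le pot']] := @refine_step V E k r c P (m j.+1) (m j %/ q) (2 * scale M r j) tP (tW j P jJ' tP Pm)
    (m0 j.+1 jJ) fullP.
  have Ml : M * (nlabels r (2 * scale M r j) * m j.+1) <= n.
    by rewrite mulnA mulnC; exact: leq_trunc_div.
  exists P'; split=> //.
    move: le; rewrite -/n -(leq_pmul2l M0) mulnDr => /leq_trans; apply.
    by rewrite leq_add2l.
  move: pot'; rewrite -(leq_pmul2l D0) !mulnDr => pot'.
  have loss : D * (r * (nlabels r (2 * scale M r j) * m j.+1 * n ^ k.-1)) <= n ^ k.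
    rewrite -[in leqRHS](prednK k0) expnS !mulnA leq_mul2r; apply/orP; right.
    by apply: leq_trans Ml; rewrite -!mulnA mulnA leq_mul2r DM orbT.
  by move: pot pot' irr loss; rewrite -/n mulSn; clear; lia.
have [P [tP _ _ pot]] := step J (leqnn J).
have := card_empties E k c tP; rewrite -/n -(leq_pmul2l D0) => le.
have : J * n ^ k <= D * (r * n ^ k) by exact: leq_trans pot le.
by rewrite mulnA leq_pmul2r ?expn_gt0 ?n0 // ltnn.
Qed.

(** * Embedding a packing of clusters *)

Lemma index_slice (A : eqType) (s : seq A) i j x : uniq s ->
  x \in take j (drop i s) -> i <= index x s < i + j.
Proof.
move=> us xs; have := xs; rewrite -index_mem size_take_min leq_min => /andP[dj ds].
rewrite size_drop in ds; set d := index x _ in dj ds.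
have -> : x = nth x s (i + d).
  by rewrite -nth_drop -(nth_take x dj) nth_index.
by rewrite index_uniq // ?leq_addr ?ltn_add2l //; move: ds; clear; lia.
Qed.

Definition slice (V : finType) (X : {set V}) (i j : nat) : {set V} :=
  [set x in take j (drop i (enum X))].

Lemma slice_sub (V : finType) (X : {set V}) i j : slice X i j \subset X.
Proof. by apply/subsetP => x; rewrite inE => /mem_take/mem_drop; rewrite mem_enum. Qed.

Lemma card_slice (V : finType) (X : {set V}) i j : i + j <= #|X| -> #|slice X i j| = j.
Proof.
move=> le; rewrite cardsE (card_uniqP _) ?take_uniq ?drop_uniq ?enum_uniq //.
by rewrite size_takel // size_drop -cardE; move: le; clear; lia.
Qed.

Lemma slice_disjoint (V : finType) (X : {set V}) i j i' j' : i + j <= i' ->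
  [disjoint slice X i j & slice X i' j'].
Proof.
move=> le; apply/pred0P => x /=; apply/negP; rewrite !inE.
move=> /andP[/(index_slice (enum_uniq _)) h /(index_slice (enum_uniq _))].
by move: h le; clear; lia.
Qed.

Section Embedding.
Variables (T V : finType) (E : {set {set V}}) (k h m : nat) (U : T -> {set V}).
Variable H : hypergraph T.
Hypotheses (k2 : 2 <= k) (h3 : 3 <= h) (hm : 17 * h <= m).
Hypothesis Ek : {in E, forall S : {set V}, #|S| = k}.
Hypothesis dU : forall a b, a != b -> [disjoint U a & U b].
Hypothesis cU : forall a, #|U a| = m.
Hypothesis hfH : {in edges H, forall e : {set T}, hole_free E h e U}.
Hypothesis conH : shadow_connected H.

(** Each cluster is sliced into two halves of size [m1] and two reserves of size [3 * h]. The
    reserves and the rounding cost at most [7 * h] vertices of a cluster, the search and the landing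
    zones [9 * h]; together [16 * h]. *)
Lemma loose_cycle_of_slots (Z : seq (seq T)) : Z != [::] ->
  (forall z, z \in Z -> [/\ size z = k, uniq z & [set c in z] \in edges H]) ->
  (forall s, uniq (flatten [seq slot k s z | z <- Z])) ->
  size Z * (#|T| * k) <= h ->
  exists C : hypergraph V, [/\ loose_cycle k C, edges C \subset E &
    size Z * (k - 1) * m <= #|verts C| + size Z * (k - 1) * (16 * h)].
Proof.
case: Z => [//|z Zs] _ gZ uZ hZ; pose m1 := (m - 6 * h) %/ 2.
have x0 : T by have [sz _ _] := gZ z (mem_head _ _); case: z sz k2 {gZ uZ hZ} => // <-.
have m1E : 2 * m1 <= m - 6 * h < 2 * m1 + 2.
  by rewrite /m1; have := divn_eq (m - 6 * h) 2; have := ltn_pmod (m - 6 * h) (isT : 0 < 2); lia.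
have m15 : 5 * h <= m1 by move: m1E hm h3; clear; lia.
pose Hf (s : bool) b := slice (U b) (if s then m1 else 0) m1.
pose Rv (s : bool) b := slice (U b) (2 * m1 + if s then 3 * h else 0) (3 * h).
have conn : {in cover (edges H) &, forall a b, connect (adjacent (edges H)) a b}.
  move=> a b /(subsetP (edges_sub H)) aH /(subsetP (edges_sub H)) bH.
  apply: connect_sub (conH aH bH) => x y /andP[_ xy]; exact: connect1.
have [||||||||bs [cyc bl un sz]] := @long_block_cycle T V E k h m1 x0 (edges H) U Hf Rv
  k2 _ m15 Ek dU hfH _ _ _ _ _ _ _ conn z Zs gZ uZ hZ.
- by apply: leq_trans h3.
- by move=> s b; exact: slice_sub.
- by move=> s b; exact: slice_sub.
- by move=> b; apply: slice_disjoint; rewrite addn0.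
- by move=> b; apply: slice_disjoint.
- by move=> s s' b; apply: slice_disjoint; case: s; lia.
- move=> s b _; rewrite card_slice // cU.
  by case: s; move: m1E; clear; lia.
- move=> s b _; rewrite card_slice // cU.
  by case: s; move: m1E hm; clear; lia.
(* Every cluster edge contributes at least [2 * m1 - 9 * h >= h >= 3] blocks. *)
have bs3 : 3 <= size bs.
  by move: sz m15 h3; clear; nia.
have [C [lC CE cC]] := loose_cycle_of_blocks k2 cyc bl un bs3.
exists C; split=> //; rewrite cC [size (z :: Zs)]/=.
have e1 : m <= 2 * m1 + 7 * h by move: m1E hm h3; clear; lia.
have aux N B : N * (2 * m1) <= B + N * (9 * h) -> N * m <= B + N * (16 * h).
  by have := leq_mul (leqnn N) e1; clear; lia.
rewrite (mulnAC _ (k - 1) m) (mulnAC _ (k - 1) (16 * h)) -mulnDl leq_mul2r.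
by rewrite (aux _ _ sz) orbT.
Qed.
End Embedding.

Lemma packing_slots (T : finType) (k l : nat) (H : hypergraph T)
    (C : 'I_l -> hypergraph T) : 2 <= k ->
  (forall i, subhypergraph (C i) H /\ loose_cycle k (C i)) ->
  (forall i j, i != j -> [disjoint verts (C i) & verts (C j)]) ->
  exists Z : seq (seq T),
    [/\ forall z, z \in Z -> [/\ size z = k, uniq z & [set c in z] \in edges H],
        forall s, uniq (flatten [seq slot k s z | z <- Z]) &
        size Z * (k - 1) = \sum_(i < l) #|verts (C i)|].
Proof.
move=> k2 lC dC.
suff [Z [gZ uZ _ sZ]] : exists Z : seq (seq T),
    [/\ forall z, z \in Z -> [/\ size z = k, uniq z & [set c in z] \in edges H],
        forall s, uniq (flatten [seq slot k s z | z <- Z]),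
        forall s c, c \in flatten [seq slot k s z | z <- Z] ->
          exists2 i, i \in index_enum 'I_l & c \in verts (C i) &
        size Z * (k - 1) = \sum_(i <- index_enum 'I_l) #|verts (C i)|].
  by exists Z.
elim: (index_enum 'I_l) (index_enum_uniq 'I_l) => [_|i s IH /= /andP[is_ us]].
  by exists [::]; rewrite big_nil; split.
have [Z [gZ uZ vZ sZ]] := IH us.
have [[_ eCH] lCi] := lC i.
have [Z1 [gZ1 uZ1 vZ1 sZ1]] := loose_cycle_slots k2 lCi.
exists (Z1 ++ Z); split.
- move=> z; rewrite mem_cat => /orP[/gZ1[? ? zC]|/gZ//]; split=> //.
  exact: subsetP zC.
- move=> t; rewrite map_cat flatten_cat cat_uniq uZ1 uZ andbT; apply/hasPn => c.
  move=> /vZ[j js cj]; apply/negP => /vZ1 ci.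
  have ij : i != j by apply: contraNneq is_ => ->.
  by have /pred0P/(_ c)/= := dC i j ij; rewrite ci cj.
- move=> t c; rewrite map_cat flatten_cat mem_cat => /orP[/vZ1 ci|/vZ[j js cj]].
    by exists i; rewrite ?mem_head.
  by exists j; rewrite // inE js orbT.
- by rewrite size_cat mulnDl big_cons sZ -sZ1 subn1.
Qed.

(** * The reduced hypergraph and the choice of constants *)

Lemma hole_free_imset (T V : finType) (E : {set {set V}}) (h : nat) (e : {set T})
    (U : T -> {set V}) : injective U ->
  hole_free E h (U @: e) id -> hole_free E h e U.
Proof.
move=> injU hf A AU hA.
pose A' B := \bigcup_(b in e | U b == B) A b.
have A'E b : b \in e -> A' (U b) = A b.
  move=> be; apply/setP => x; apply/bigcupP/idP => [[b' /andP[_ /eqP/injU->]]//|xb].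
  by exists b; rewrite ?be ?eqxx.
have [||S SE /andP[/subsetP sub /forall_inP one]] := hf A'.
- by move=> _ /imsetP[b be ->]; rewrite A'E //; exact: AU.
- by move=> _ /imsetP[b be ->]; rewrite A'E //; exact: hA.
exists S => //; apply/andP; split.
  apply/subsetP => x /sub /bigcupP[_ /imsetP[b be ->]]; rewrite A'E // => xb.
  by apply/bigcupP; exists b.
by apply/forall_inP => b be; rewrite -(A'E b be) one // imset_f.
Qed.

(** Each factor t - j of the falling factorial with j < k is at least t / k. *)
Lemma expn_le_bin t k : 0 < k -> k <= t -> t ^ k <= k ^ k * k`! * 'C(t, k).
Proof.
move=> k0 kt; rewrite -mulnA [_`! * _]mulnC bin_ffact.
suff H j : j <= k -> t ^ j <= k ^ j * t ^_ j by exact: H.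
elim: j => [//|j IH] jk; rewrite !expnSr ffactnSr.
rewrite mulnACA; apply: leq_mul; first exact: IH (ltnW jk).
have : j * 1 <= k.-1 * (t - j) by apply: leq_mul; move: jk kt; clear; lia.
by rewrite -[in k * _](prednK k0) mulSn; move: jk kt; clear; lia.
Qed.

Import Order.TTheory GRing.Theory Num.Theory.

Lemma size_slots (T : finType) k (Z : seq (seq T)) : 2 <= k ->
  (forall z, z \in Z -> size z = k) -> uniq (flatten [seq slot k false z | z <- Z]) ->
  size Z <= #|T|.
Proof.
move=> k2 sZ u; apply: (@leq_trans (size (flatten [seq slot k false z | z <- Z]))).
  rewrite (@size_flatten_blocks _ k.-1).
    by rewrite size_map leq_pmulr //; move: k2; clear; lia.
  apply/allP => _ /mapP[z zZ ->].
  by rewrite /slot size_takel // sZ // leq_pred.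
by rewrite -(card_uniqP u) max_card.
Qed.

Lemma exists_nat_ge (R : realType) (x : R) : exists N : nat, (x <= N%:R)%R.
Proof.
exists (Num.bound `|x|%R); apply: le_trans (ler_norm x) _.
by apply/ltW/archi_boundP/normr_ge0.
Qed.

(** The uncovered vertices cost a fraction 1 / [M], the embedding a fraction 16 / [q]; the two
    bounds on [y] make each loss at most [alpha / 4] times [n]. *)
Lemma packing_bound (R : realFieldType) (y alpha s m t n M q h v : R) :
  (0 <= y -> 0 <= s -> 0 <= m -> 0 <= n -> 0 < M -> 16 <= q ->
   s * m <= v + s * (16 * h) -> h * q <= m -> M * n <= M * (t * m) + n ->
   4 * y <= M * alpha -> 64 * y <= q * alpha -> y * t <= s ->
   (y - alpha / 2) * n <= v)%R.
Proof.
move=> y0 s0 m0 n0 M0 q16 hv hq cov yM yq yt.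
have q0 : (0 <= q)%R by apply: le_trans q16; rewrite ler0n.
have q160 : (0 <= q - 16)%R by rewrite subr_ge0.
have e1 : (s * m * (q - 16) <= q * v)%R.
  have := ler_wpM2l q0 hv; have := ler_wpM2l s0 hq; clear; lra.
have e2 : (y * (t * m) * (q - 16) <= q * v)%R.
  by apply: le_trans e1; apply: ler_wpM2r => //; rewrite mulrA; exact: ler_wpM2r.
have e3 : (y * (q - 16) * (M * n - n) <= M * q * v)%R.
  have := ler_wpM2l (ltW M0) e2; have := ler_wpM2l (mulr_ge0 y0 q160) cov.
  by clear; lra.
have qM0 : (0 < M * q)%R by rewrite mulr_gt0 // (lt_le_trans _ q16) // ltr0n.
rewrite -(ler_pM2l qM0); apply: le_trans e3.
have f1 : (0 <= (M * alpha - 4 * y) * (q * n))%R by rewrite !mulr_ge0 // subr_ge0.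
have f2 : (0 <= (q * alpha - 64 * y) * (M * n))%R.
  by rewrite !mulr_ge0 ?(ltW M0) // subr_ge0.
have f3 : (0 <= y * n)%R by rewrite mulr_ge0.
by move: f1 f2 f3; clear; lra.
Qed.

(** The error [alpha] is shared equally between the packing of clusters and its embedding. *)
Lemma long_mono_cycle (R : realType) (k r : nat) (psi alpha : R) :
  2 <= k -> (0 < alpha)%R ->
  (exists (eps' : R) (t0 : nat), (0 < eps')%R /\
      forall (T : finType) (G : hypergraph T) (t : nat),
        #|verts G| = t -> t0 <= t -> k_uniform k G ->
        ((1 - eps') * 'C(t, k)%:R <= #|edges G|%:R)%R ->
        forall c : {set T} -> 'I_r,
          exists s : nat, ((psi - alpha / 2) * t%:R <= s%:R)%R
                          /\ mono_packing k c G s) ->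
  exists W N0, 0 < W /\ forall (V : finType) (E : {set {set V}}),
    N0 <= #|V| -> {in E, forall S : {set V}, #|S| = k} ->
    box_full E k (#|V| %/ W) -> forall c : {set V} -> 'I_r,
    exists C : hypergraph V, [/\ loose_cycle k C, edges C \subset E,
      monochromatic c C & ((psi - alpha) * #|V|%:R <= #|verts C|%:R)%R].
Proof.
move=> k2 alpha0 [eps [t0 [eps0 hG]]].
have k0 : 0 < k by exact: leq_trans k2.
pose y : R := (psi - alpha / 2)%R.
have [q1 hq1] := exists_nat_ge (64 * y / alpha)%R.
pose q := q1 + 17.
(* From n <= 4 q t h, with t clusters, follows 2 n^k <= [Q] C(t, k) h^k, so fewer than [Q] C(t, k) /
   [D] tuples are irregular. *)
pose Q := 2 * (4 * q) ^ k * (k ^ k * k`!).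
have [D1 hD1] := exists_nat_ge (Q%:R / eps)%R.
pose D := D1 + 2 * Q + 1.
have [M1 hM1] := exists_nat_ge (4 * y / alpha)%R.
(* The summands serve, in turn, the loss of uncovered vertices, the potential argument, and having
   at least [t0 + k] clusters. *)
pose M := M1 + D * r + 2 * (t0 + k) + 2.
have D0 : 0 < D by rewrite /D addn1.
have M2 : 2 <= M by rewrite /M leq_addl.
have DM : D * r <= M by rewrite /M; move: (D * r) (2 * _); clear; lia.
have M4 : 2 * (t0 + k) <= M by rewrite /M; move: (D * r); clear; lia.
have q17 : 17 <= q by rewrite leq_addl.
have [W W0 reg] := regular_partition q k0 D0 DM M2.
(* A packing has at most [2 * W] cluster edges, each costing a connection of at most [2 * W * k]
   vertices; [h] must dominate the total. *)
pose B := 4 * W ^ 2 * k + 3.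
exists W, (W * (q * B)); split=> // V E hn Ek full c.
set n := #|V| in hn full *.
have q0 : 0 < q by exact: leq_trans q17.
have Wn : W <= n.
  by apply: leq_trans hn; rewrite leq_pmulr // muln_gt0 q0 /B addn3.
have [P [m [[tP Pm] [Wm mM] tW cov irr]]] := reg V E c Wn full.
have qBm : q * B <= m by apply: leq_trans Wm; rewrite leq_divRL // mulnC.
set h := m %/ q in irr.
have Bh : B <= h by rewrite leq_divRL // mulnC.
have hqm : h * q <= m by exact: leq_trunc_div.
have h3 : 3 <= h by apply: leq_trans Bh; rewrite leq_addl.
have m2h : m <= 2 * (q * h).
  have := ltn_ceil m q0; rewrite -/h; move: h3; clear; nia.
have m0 : 0 < m by move: hqm h3 q0; clear; nia.
set t := #|P| in tW cov.
have n2 : n <= 2 * (t * m) by move: cov M2; rewrite -/n; move: (t * m); clear; nia.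
have tt0 : t0 + k <= t.
  have : m * M <= m * (2 * t) by rewrite [leqRHS]mulnCA (mulnC m t); exact: leq_trans mM n2.
  by rewrite leq_pmul2l // => /(leq_trans M4); rewrite leq_pmul2l.
have kt : k <= t by apply: leq_trans tt0; exact: leq_addl.
have irrC : D * #|irregular E k c h P| < Q * 'C(t, k).
  have hk0 : 0 < h ^ k by rewrite expn_gt0 (leq_trans _ h3).
  rewrite -(ltn_pmul2r hk0) -mulnA; apply: leq_trans irr _.
  apply: (@leq_trans (2 * (4 * q * t * h) ^ k)).
    rewrite leq_mul2l /= leq_exp2r //; apply: leq_trans n2 _.
    by move: m2h; clear; nia.
  rewrite (expnMn (4 * q * t)) (expnMn (4 * q)) /Q.
  have := leq_mul (leq_mul (leqnn (2 * (4 * q) ^ k)) (expn_le_bin k0 kt)) (leqnn (h ^ k)).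
  by rewrite !mulnA.
have C0 : 0 < 'C(t, k) by rewrite bin_gt0.
pose U := @enum_val _ (mem P).
have cT : #|'I_(#|P|)| = t by rewrite card_ord.
have UP b : U b \in P by exact: enum_valP.
have injU : injective U by exact: enum_val_inj.
have dU a b : a != b -> [disjoint U a & U b].
  by move=> ab; apply: (trivIsetP tP) => //; rewrite (inj_eq injU).
have cU a : #|U a| = m by exact: Pm.
pose EG := [set e : {set 'I_(#|P|)} | (#|e| == k) && (U @: e \notin irregular E k c h P)].
pose G := on_all EG.
have cEG : 'C(t, k) <= #|EG| + #|irregular E k c h P|.
  rewrite -{1}cT -card_draws.
  pose Bd := [set e : {set 'I_(#|P|)} | U @: e \in irregular E k c h P].
  apply: (@leq_trans #|EG :|: Bd|).
    apply/subset_leq_card/subsetP => e; rewrite in_set => ek; rewrite in_setU.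
    have [eI|nI] := boolP (U @: e \in irregular E k c h P); apply/orP.
      by right; rewrite in_set.
    by left; rewrite in_set ek nI.
  apply: leq_trans (leq_card_setU _ _) _; rewrite leq_add2l.
  rewrite -(card_imset _ (imset_inj injU)); apply/subset_leq_card/subsetP => B'.
  by case/imsetP => e; rewrite in_set => eI ->.
have EGpos : 0 < #|EG|.
  rewrite lt0n; apply/eqP => EG0; move: cEG; rewrite EG0 add0n => le.
  have : D * 'C(t, k) < Q * 'C(t, k).
    by apply: leq_ltn_trans irrC; rewrite leq_mul2l le orbT.
  by rewrite ltn_pmul2r // /D; clear; lia.
have EGeps : ((1 - eps) * 'C(t, k)%:R <= #|edges G|%:R)%R.
  have h1 : ('C(t, k)%:R <= #|EG|%:R + #|irregular E k c h P|%:R :> R)%R.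
    by rewrite -natrD ler_nat.
  have h2 : (D%:R * #|irregular E k c h P|%:R <= Q%:R * 'C(t, k)%:R :> R)%R.
    by rewrite -!natrM ler_nat ltnW.
  have h3' : (Q%:R <= D%:R * eps)%R.
    have : (Q%:R <= D1%:R * eps)%R by rewrite -ler_pdivrMr.
    move=> /le_trans; apply; rewrite ler_wpM2r ?(ltW eps0) // ler_nat.
    by rewrite /D -addnA leq_addr.
  have D0' : (0 < D%:R :> R)%R by rewrite ltr0n.
  have : (#|irregular E k c h P|%:R <= eps * 'C(t, k)%:R)%R.
    rewrite -(ler_pM2l D0'); apply: le_trans h2 _; rewrite mulrA.
    by rewrite ler_wpM2r ?ler0n.
  by rewrite mulrBl mul1r lerBlDr /= => Ce; apply: le_trans h1 _; rewrite lerD2l.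
have EGk : k_uniform k G by move=> e; rewrite in_set => /andP[/eqP].
(* The colouring of the reduced hypergraph: a tuple receives a colour in which it is hole-free. *)
have /choice[c' hc'] : forall e, exists i, e \in EG ->
    hole_free (color_class E c i) h e U.
  move=> e; have [eE|] := boolP (e \in EG); last by exists (c set0).
  have := eE; rewrite in_set => /andP[/eqP ek nirr].
  have fam : U @: e \in kfamilies k P.
    rewrite inE (card_imset _ injU) ek eqxx andbT.
    by apply/subsetP => _ /imsetP[b _ ->].
  move: nirr; rewrite inE fam /= => /asboolPn nirr.
  have [[i hi]|no] := pselect (exists i, hole_free (color_class E c i) h (U @: e) id).
    by exists i => _; exact: hole_free_imset.
  by case: nirr => i hi; apply: no; exists i.
suff [H [Z [i [cH hH Z0 gZ [uZ yZ]]]]] : exists (H : hypergraph 'I_(#|P|)) Z i,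
    [/\ shadow_connected H,
        {in edges H, forall e : {set 'I_(#|P|)}, hole_free (color_class E c i) h e U},
        Z != [::],
        (forall z, z \in Z -> [/\ size z = k, uniq z & [set c in z] \in edges H]) &
        (forall s, uniq (flatten [seq slot k s z | z <- Z])) /\
        ((psi - alpha <= 0)%R \/ (0 < y /\ y * t%:R <= (size Z * (k - 1))%:R)%R)].
  have hm : 17 * h <= m by apply: leq_trans hqm; rewrite mulnC leq_mul2l q17 orbT.
  have Eik : {in color_class E c i, forall S : {set V}, #|S| = k}.
    by move=> S; rewrite inE => /andP[/Ek].
  have hZ : size Z * (#|'I_(#|P|)| * k) <= h.
    have sZt : size Z <= t.
      by rewrite -cT; apply: (size_slots k2) (uZ false) => z /gZ[].
    apply: leq_trans Bh; rewrite cT mulnA; apply: leq_trans (leq_addr _ _).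
    rewrite leq_mul2r; apply/orP; right.
    apply: leq_trans (leq_mul (leq_trans sZt tW) tW) _.
    by rewrite mulnACA mulnn.
  have [C [lC CE cC]] := loose_cycle_of_slots k2 h3 hm Eik dU cU hH cH Z0 gZ uZ hZ.
  exists C; split=> //.
  - by apply: subset_trans CE _; apply/subsetP => S; rewrite inE => /andP[].
  - move=> e f /(subsetP CE) + /(subsetP CE).
    by rewrite !inE => /andP[_ /eqP->] /andP[_ /eqP->].
  case: yZ => [neg|[y0 yZ]].
    by apply: le_trans (ler0n _ _); rewrite mulr_le0_ge0 // ler0n.
  set S := size Z * (k - 1) in cC yZ.
  have cC' : (S%:R * m%:R <= #|verts C|%:R + S%:R * (16 * h%:R) :> R)%R.
    by rewrite -!natrM -natrD ler_nat.
  have hqm' : (h%:R * q%:R <= m%:R :> R)%R by rewrite -natrM ler_nat.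
  have cov' : (M%:R * n%:R <= M%:R * (t%:R * m%:R) + n%:R :> R)%R.
    by rewrite -!natrM -natrD ler_nat.
  have yM : (4 * y <= M%:R * alpha)%R.
    rewrite -ler_pdivrMr //; apply: le_trans hM1 _.
    by rewrite ler_nat /M -!addnA leq_addr.
  have yq : (64 * y <= q%:R * alpha)%R.
    rewrite -ler_pdivrMr //; apply: le_trans hq1 _.
    by rewrite ler_nat /q leq_addr.
  have q16 : (16 <= q%:R :> R)%R by rewrite ler_nat ltnW.
  have M1' : (0 < M%:R :> R)%R by rewrite ltr0n ltnW.
  have -> : (psi - alpha = y - alpha / 2)%R by rewrite /y -addrA -opprD -splitr.
  exact: packing_bound (ltW y0) _ _ _ M1' q16 cC' hqm' cov' yM yq yZ; rewrite ler0n.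
(* If the required length is not positive, any monochromatic loose cycle will do, and a single
   cluster edge provides one. *)
have [neg|pos] := leP (psi - alpha)%R 0%R.
  have [e eE] : exists e, e \in EG by apply/card_gt0P.
  have ek := EGk e eE.
  have sub : cover [set e] \subset e by rewrite cover1.
  exists (Hypergraph sub), [:: enum e], (c' e); split=> //.
  - move=> a b ae be; have [->|ab] := eqVneq a b; first exact: connect0.
    apply: connect1; rewrite /shadow ab /=; apply/exists_inP.
    by exists e; rewrite ?set11 // ae be.
  - by move=> f; rewrite inE => /eqP->; exact: hc'.
  - move=> z; rewrite inE => /eqP->; rewrite -cardE enum_uniq; split=> //.
    by rewrite inE; apply/eqP/setP => x; rewrite inE mem_enum.
  - split; last by left.
    move=> s; rewrite /= cats0 /slot; case: s; last by rewrite take_uniq ?enum_uniq.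
    by rewrite -drop1 drop_uniq ?enum_uniq.
have y0 : (0 < y)%R by rewrite /y; move: pos alpha0; clear; lra.
have cG : #|verts G| = t by rewrite /= cardsT.
have [s [ys [H [l [C [[[_ HG] cH] mH lC dC sC]]]]]] :=
  hG _ G t cG (leq_trans (leq_addr _ _) tt0) EGk EGeps c'.
have [Z [gZ uZ sZ]] := packing_slots k2 lC dC.
have s0 : 0 < s.
  rewrite -(ltr_nat R); apply: lt_le_trans ys; rewrite mulr_gt0 // ltr0n.
  exact: leq_trans kt.
have Z0 : Z != [::] by apply: contraTneq s0 => Z0; rewrite -sC -sZ Z0.
have [z0 z0Z] : exists z0, z0 \in Z by case: (Z) Z0 => // z0 ?; exists z0; rewrite mem_head.
have [_ _ e0H] := gZ z0 z0Z.
exists H, Z, (c' [set c in z0]); split=> //.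
- move=> e eH; rewrite (mH _ _ e0H eH); apply: hc'.
  exact: subsetP HG _ eH.
- by split=> //; right; rewrite sZ sC.
Qed.

(** * The random hypergraph *)

Local Open Scope ring_scope.

(** Besides the total mass 1, it gives the probability that prescribed edges are absent, by putting
    [F] equal to 0 on them. *)
Lemma sum_powerset_prod (R : comNzRingType) (T : finType) (K : {set T}) (F G : T -> R) :
  \sum_(E in powerset K) \prod_(e in K) (if e \in E then F e else G e) =
  \prod_(e in K) (F e + G e).
Proof.
rewrite [RHS]big_mkcond.
rewrite (eq_bigr (fun e => (if e \in K then F e else 0) + (if e \in K then G e else 1))).
  rewrite bigA_distr [RHS](bigID (fun E : {set T} => E \in powerset K)) /=.
  rewrite [X in _ = _ + X]big1 ?addr0.
    apply: eq_bigr => E; rewrite powersetE => /subsetP EK; rewrite big_mkcond /=.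
    by apply: eq_bigr => e _; have := EK e; case: (e \in E); case: (e \in K) => // /(_ isT).
  move=> E; rewrite powersetE => /subsetPn[e eE eK].
  by rewrite (bigD1 e) //= eE (negPf eK) mul0r.
by move=> e _; case: (e \in K); rewrite ?add0r.
Qed.

(** A polynomial substitute for the bound of (1 - p)^N by exp(-N p). *)
Lemma bernoulli_inv (R : realFieldType) (p : R) (N : nat) : 0 <= p <= 1 ->
  (1 - p) ^+ N * (1 + N%:R * p) <= 1.
Proof.
move=> /andP[p0 p1]; elim: N => [|N IH]; first by rewrite mul0r addr0 mulr1.
apply: le_trans IH; rewrite exprSr -mulrA; apply: ler_wpM2l.
  by rewrite exprn_ge0 // subr_ge0.
have N0 : 0 <= N%:R :> R by rewrite ler0n.
rewrite -natr1 -subr_ge0.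
have -> : 1 + N%:R * p - (1 - p) * (1 + (N%:R + 1) * p) = (N%:R + 1) * (p * p) by ring.
by rewrite mulr_ge0 ?mulr_ge0 // addr_ge0.
Qed.

Section Probability.
Variables (R : realType) (k n : nat) (p : R).
Hypothesis p01 : 0 <= p <= 1.

Let w (E : {set {set 'I_n}}) : R :=
  \prod_(e in ksubsets k n) (if e \in E then p else 1 - p).

Let w_ge0 E : 0 <= w E.
Proof.
have /andP[p0 p1] := p01; apply: prodr_ge0 => e _.
by case: ifP => _ //; rewrite subr_ge0.
Qed.

Let sum_w : \sum_(E in powerset (ksubsets k n)) w E = 1.
Proof.
rewrite sum_powerset_prod; apply: big1 => e _.
by rewrite addrC subrK.
Qed.

Lemma prob_Hnp_le1 (P : hypergraph 'I_n -> Prop) : prob_Hnp k p P <= 1.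
Proof.
rewrite -sum_w (bigID (fun E => `[< P (on_all E) >])) /= lerDl.
by apply: sumr_ge0 => E _; exact: w_ge0.
Qed.

Lemma sum_disjoint (B : {set {set 'I_n}}) : B \subset ksubsets k n ->
  \sum_(E in powerset (ksubsets k n) | [disjoint E & B]) w E = (1 - p) ^+ #|B|.
Proof.
move=> BK.
have -> : (1 - p) ^+ #|B| =
    \prod_(e in ksubsets k n) ((if e \in B then 0 else p) + (1 - p)).
  rewrite (big_setID B) /= (setIidPr BK) [X in _ * X]big1 ?mulr1.
    rewrite -prodr_const; apply: eq_bigr => e eB.
    by rewrite eB add0r.
  by move=> e; rewrite inE => /andP[/negPf-> _]; rewrite addrC subrK.
rewrite -sum_powerset_prod [RHS](bigID (fun E : {set _} => [disjoint E & B])) /=.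
rewrite [X in _ = _ + X]big1 ?addr0.
  apply: eq_bigr => E /andP[_ dEB]; apply: eq_bigr => e _.
  case: ifP => eE //; case: ifP => eB //.
  by have /pred0P/(_ e)/= := dEB; rewrite eE eB.
move=> E /andP[EK /pred0Pn[e /= /andP[eE eB]]].
by rewrite (bigD1 e) ?(subsetP BK) //= eE eB mul0r.
Qed.

(** Union bound: there are at most (2^n)^k families of [k] disjoint sets of size at least [h], and a
    family without a crossing edge lacks at least [h ^ k] prescribed edges. *)
Lemma prob_box_full (h : nat) (P : hypergraph 'I_n -> Prop) :
  (forall E : {set {set 'I_n}}, E \subset ksubsets k n -> box_full E k h -> P (on_all E)) ->
  1 - (2 ^ n)%:R ^+ k * (1 - p) ^+ (h ^ k) <= prob_Hnp k p P.
Proof.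
move=> full; have /andP[p0 p1] := p01.
rewrite lerBlDr -[leLHS]sum_w (bigID (fun E => `[< P (on_all E) >])) /= lerD2l.
pose X e := [set S : {set 'I_n} | crossing e id S].
pose K := [set e : {set {set 'I_n}} | [&& trivIset e, #|e| == k &
  [forall b in e, h <= #|b|]%N]].
have dK e : e \in K -> {in e &, forall a b : {set 'I_n}, a != b -> [disjoint id a & id b]}.
  by rewrite inE => /and3P[/trivIsetP te _ _] a b; exact: te.
have XK e : e \in K -> X e \subset ksubsets k n.
  move=> eK; apply/subsetP => S; rewrite !inE => cr.
  by rewrite (card_crossing (dK e eK) cr); move: eK; rewrite inE => /and3P[].
apply: (@le_trans _ _ (\sum_(e in K)
    \sum_(E in powerset (ksubsets k n) | [disjoint E & X e]) w E)).
  rewrite (exchange_big_dep (fun E : {set {set 'I_n}} => E \in powerset (ksubsets k n))) /=.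
    rewrite [leRHS](bigID (fun E => `[< P (on_all E) >])) /=.
    rewrite -[leLHS]add0r lerD //.
      by apply: sumr_ge0 => E _; apply: sumr_ge0 => e _; exact: w_ge0.
    apply: ler_sum => E /andP[EK /asboolPn nP].
    have [e eK dE] : exists2 e, e \in K & [disjoint E & X e].
      have [[e eK dE]|no] := pselect (exists2 e, e \in K & [disjoint E & X e]).
        by exists e.
      exfalso; apply: nP; apply: full; first by rewrite -powersetE.
      move=> e te ek eh.
      have eK : e \in K by rewrite inE te ek eqxx; apply/forall_inP.
      have /pred0Pn[S /= /andP[SE]] : ~~ [disjoint E & X e].
        by apply/negP => dE; apply: no; exists e.
      by rewrite inE => cr; exists S.
    rewrite (bigD1 e); last by rewrite eK EK dE.
    rewrite lerDl.
    by apply: sumr_ge0 => f _; exact: w_ge0.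
  by move=> e E _ /andP[].
apply: (@le_trans _ _ (\sum_(e in K) (1 - p) ^+ (h ^ k))).
  apply: ler_sum => e eK; rewrite sum_disjoint ?XK //.
  rewrite ler_wiXn2l // ?subr_ge0 ?gerBl //.
  have := eK; rewrite inE => /and3P[_ /eqP ek /forall_inP he]; rewrite -[in leqLHS]ek.
  exact: (@card_crossings _ _ e id (dK e eK) h he).
rewrite sumr_const -[leLHS]mulr_natl; apply: ler_wpM2r.
  by rewrite exprn_ge0 // subr_ge0.
rewrite -natrX ler_nat.
apply: (@leq_trans #|[set e : {set {set 'I_n}} | #|e| == k]|).
  by apply/subset_leq_card/subsetP => e; rewrite !inE => /and3P[].
rewrite card_draws; apply: leq_trans (leq_pmulr _ (fact_gt0 k)) _.
rewrite bin_ffact; apply: leq_trans (ffact_le_expn _ _) _.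
have -> : #|{: {set 'I_n}}| = (2 ^ n)%N; last by [].
by rewrite -cardsT -powersetT card_powerset cardsT card_ord.
Qed.
End Probability.

(* Asymptotics of the first-moment bound *)
From mathcomp Require Import classical_sets topology normedtype sequences.
Import numFieldNormedType.Exports.

(** With h = n / W rounded down, n <= 2 W h, so the bound is at most the h-th power of 2^(2 W k) (1
    - p)^(h^(k-1)). It suffices that this base be at most [d], for which Bernoulli's inequality is
    strong enough. *)
Lemma union_bound_small (R : realFieldType) (k n W : nat) (p d : R) :
  (0 < k)%N -> (0 < W)%N -> (W <= n)%N -> 0 <= p <= 1 -> 0 < d <= 1 ->
  (2 ^ (2 * W * k))%:R / d <= 1 + ((n %/ W) ^ k.-1)%:R * p ->
  (2 ^ n)%:R ^+ k * (1 - p) ^+ ((n %/ W) ^ k) <= d.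
Proof.
move=> k0 W0 Wn p01 /andP[d0 d1]; set h := (n %/ W)%N; set A := (2 ^ _)%:R => hA.
have /andP[p0 p1] := p01.
have h0 : (0 < h)%N by rewrite divn_gt0.
have nh : (n <= 2 * W * h)%N.
  by have := ltn_ceil n W0; rewrite -/h; move: h0; clear; nia.
have q0 : 0 <= 1 - p by rewrite subr_ge0.
apply: (@le_trans _ _ ((A * (1 - p) ^+ (h ^ k.-1)) ^+ h)).
  rewrite exprMn -exprM -expnSr prednK //; apply: ler_wpM2r.
    by rewrite exprn_ge0.
  rewrite /A -!natrX -!expnM ler_nat leq_exp2l // mulnAC leq_mul2r nh orbT //.
apply: (@le_trans _ _ (d ^+ h)); last by rewrite -[leRHS]expr1 ler_wiXn2l // ltW.
have A0 : 0 <= A by rewrite ler0n.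
apply: lerXn2r; rewrite ?nnegrE ?mulr_ge0 ?exprn_ge0 ?(ltW d0) //.
have hA' : A <= d * (1 + (h ^ k.-1)%:R * p) by rewrite mulrC -ler_pdivrMr.
apply: le_trans (ler_wpM2r _ hA') _; first by rewrite exprn_ge0.
rewrite -mulrA -[leRHS]mulr1; apply: ler_wpM2l; first exact: ltW.
by rewrite mulrC; exact: bernoulli_inv.
Qed.

Theorem theorem1p5 (R : realType) (psi : nat -> nat -> R)
  (hpsi : forall (k r : nat) (alpha' : R),
    (2 <= k)%N -> (1 <= r)%N -> 0 < alpha' ->
    exists (eps' : R) (t0 : nat), [/\ 0 < eps', (0 < t0)%N &
      forall (T : finType) (G : hypergraph T) (t : nat),
        #|verts G| = t -> (t0 <= t)%N -> k_uniform k G ->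
        (1 - eps') * 'C(t, k)%:R <= #|edges G|%:R ->
        forall c : {set T} -> 'I_r,
          exists s : nat, (psi r k - alpha') * t%:R <= s%:R
                          /\ mono_packing k c G s])
  (k r : nat) (alpha : R) (p : nat -> R) :
  (2 <= k)%N -> (1 <= r)%N -> 0 < alpha ->
  (forall n, 0 < p n <= 1) ->
  (p n * n%:R ^+ (k - 1) @[n --> \oo] --> +oo)%classic ->
  (prob_Hnp k (p n) (fun G : hypergraph 'I_n =>
      forall c : {set 'I_n} -> 'I_r,
        exists C : hypergraph 'I_n,
          [/\ subhypergraph C G, loose_cycle k C, monochromatic c C &
              (psi r k - alpha) * n%:R <= #|verts C|%:R])
   @[n --> \oo] --> (1 : R))%classic.
Proof.
move=> k2 r1 alpha0 p01 poo.
have k0 : (0 < k)%N by exact: leq_trans k2.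
have alpha2 : 0 < alpha / 2 by rewrite divr_gt0.
have [|W [N0 [W0 long]]] := @long_mono_cycle R k r (psi r k) alpha k2 alpha0.
  have [eps' [t0 [eps0 _ hG]]] := hpsi k r (alpha / 2) k2 r1 alpha2.
  by exists eps', t0.
apply/cvgrPdist_le => d d0.
(* Capping at 1 makes powers of [d1] at most [d1]. *)
pose d1 := Num.min d 1.
have d1P : 0 < d1 <= 1 by rewrite /d1 lt_min d0 ltr01 /= ge_min lexx orbT.
have /andP[d10 _] := d1P.
pose A : R := (2 ^ (2 * W * k))%:R / d1.
(* The factor (2 W)^(k-1) pays for replacing n by n / W rounded down. *)
move/cvgryPge: poo => /(_ (((2 * W) ^ k.-1)%:R * A)) poo.
near=> n.
have Wn : (W <= n)%N by near: n; exact: nbhs_infty_ge.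
have Nn : (N0 <= n)%N by near: n; exact: nbhs_infty_ge.
have pA : ((2 * W) ^ k.-1)%:R * A <= p n * n%:R ^+ (k - 1) by near: n.
have /andP[pn0 pn1] := p01 n.
have p01' : 0 <= p n <= 1 by rewrite (ltW pn0) pn1.
rewrite ger0_norm; last by rewrite subr_ge0; exact: prob_Hnp_le1.
rewrite lerBlDr -lerBlDl.
apply: (@le_trans _ _ (1 - (2 ^ n)%:R ^+ k * (1 - p n) ^+ ((n %/ W) ^ k))).
  rewrite lerB //; apply: (@le_trans _ _ d1); last by rewrite /d1 ge_min lexx.
  apply: union_bound_small => //; rewrite -/A.
  apply: (@le_trans _ _ (((n %/ W) ^ k.-1)%:R * p n)); last by rewrite lerDr.
  have W2 : (0 : R) < ((2 * W) ^ k.-1)%:R by rewrite ltr0n expn_gt0 muln_gt0 W0.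
  rewrite -(ler_pM2l W2); apply: le_trans pA _.
  rewrite mulrA mulrC -natrM -expnMn subn1 -natrX; apply: ler_wpM2r; first exact: ltW.
  rewrite ler_nat leq_exp2r ?prednK //; last by move: k2; clear; lia.
  have := ltn_ceil n W0; have : (0 < n %/ W)%N by rewrite divn_gt0.
  by clear; nia.
apply: prob_box_full => // E Ek full c.
have Ek' : {in E, forall S : {set 'I_n}, #|S| = k}.
  by move=> S SE; have := fintype.subsetP Ek S SE; rewrite inE => /eqP.
have [||C [lC CE mC cC]] := long 'I_n E _ Ek' _ c; rewrite ?card_ord //.
by exists C; split=> //; [split=> //; exact: finset.subsetT | move: cC; rewrite card_ord].
Unshelve. all: by end_near.
Qed.
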